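(* Let $X$ be a WLD Banach space. Then $X$ admits an overcomplete set if and only if the density of $X$ is less than or equal to $\omega_1$.
   Context: All Banach spaces are infinite dimensional and over the reals. $dens(X)$ (the density) is the minimal cardinality of a norm dense subset of $X$. A subset $Y$ of a Banach space $X$ is called overcomplete (in $X$) if $|Y|=dens(X)$ and every $Z\subseteq Y$ with $|Z|=|Y|$ is linearly dense in $X$ (its linear span is norm dense in $X$). $X$ is WLD (weakly Lindelöf determined) if it admits a linearly dense set $D\subseteq X$ such that $\{d\in D: x^*(d)\neq 0\}$ is countable for each $x^*\in X^*$. *)

(* Defs.v *)
From HB Require Import structures.
From mathcomp Require Import all_boot all_order all_algebra.
From mathcomp Require Import all_classical all_reals all_analysis.
From mathcomp Require wochoice.

Set Implicit Arguments.
Unset Strict Implicit.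
Unset Printing Implicit Defensive.

Import Order.TTheory GRing.Theory Num.Theory.
Import numFieldNormedType.Exports.

Local Open Scope classical_set_scope.
Local Open Scope ring_scope.
Local Open Scope card_scope.

(* A well-ordered subset of nat: a pair (C, r) such that r well-orders C.
   The values of r outside C are irrelevant. *)
Definition is_wo (w : pred nat * rel nat) : Prop := wochoice.wo_chain w.2 w.1.

Definition wo_iso (w w' : pred nat * rel nat) : Prop :=
  exists f : nat -> nat, set_bij [set` w.1] [set` w'.1] f /\
    {in w.1 &, forall x y, w'.2 (f x) (f y) = w.2 x y}.

(* omega_1 is the set of countable ordinals, an ordinal being represented by
   the isomorphism class of the well-ordered subsets of nat of that type;
   finite subsets are included, so the finite ordinals are there too. *)
Definition omega1 : set (set (pred nat * rel nat)) :=
  [set a | exists2 w, is_wo w & a = [set w' | is_wo w' /\ wo_iso w w']].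

Section BanachNotions.
Context {R : realType} {X : completeNormedModType R}.

Definition linspan (A : set X) : set X :=
  [set x | exists (n : nat) (a : 'I_n -> R) (v : 'I_n -> X),
     (forall i, A (v i)) /\ x = \sum_(i < n) a i *: v i].

Definition linearly_dense (A : set X) : Prop := dense (linspan A).

(* Cardinals are represented by sets up to equinumerosity: the cardinality of
   K is dens(X), the least cardinality of a dense subset of X. *)
Definition card_is_dens (K : set X) : Prop :=
  (exists2 D : set X, dense D & K #= D) /\
  (forall D : set X, dense D -> K #<= D).

Definition overcomplete (Y : set X) : Prop :=
  card_is_dens Y /\
  (forall Z : set X, Z `<=` Y -> Z #= Y -> linearly_dense Z).

End BanachNotions.

Definition infinite_dimensional (R : realType) (X : completeNormedModType R) :
  Prop := ~ exists2 A : set X, finite_set A & linspan A = [set: X].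

Definition WLD (R : realType) (X : completeNormedModType R) : Prop :=
  exists2 D : set X, linearly_dense D &
    forall f : {linear X -> R^o}, continuous f ->
      countable [set d | D d /\ f d != 0].

(* Main.v *)
Require Import Defs.
From HB Require Import structures.
From mathcomp Require Import all_boot all_order all_algebra.
From mathcomp Require Import finmap.
From mathcomp Require Import all_classical all_reals all_analysis.
From mathcomp Require Import lra.

Import Order.TTheory GRing.Theory Num.Theory.
Import numFieldNormedType.Exports.

Local Open Scope classical_set_scope.
Local Open Scope ring_scope.
Local Open Scope card_scope.

Set Implicit Arguments.
Unset Strict Implicit.
Unset Printing Implicit Defensive.

(** Let [D] be linearly dense with countable supports.

    If [Y] is overcomplete, take a maximal family [F] of nonzero functionals
    with pairwise disjoint supports in [D]. By maximality and Hahn-Banach the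
    union of these countable supports is linearly dense, so if the density
    exceeds [omega_1] then so does the cardinality of [F]. Each [y] in [Y] is
    annihilated by all but countably many members of [F], hence [Y] is covered
    by the zero sets in [Y] of any [omega_1] of them. These zero sets are not
    linearly dense, so each is smaller than [Y]; choosing [omega_1] of them
    below a single one of them contradicts the cardinality of [Y].

    Conversely, Klee's vectors [sum_n m ^ n v_n], for [m] in ]0, 1/4] and a
    bounded linearly dense sequence [v_n], form an overcomplete set in the
    separable case: a functional vanishing at infinitely many of them gives a
    power series with infinitely many zeros. In density [omega_1], let [b]
    enumerate in type [omega_1] a linearly dense subset of [D] and let [h x] map
    the initial segment up to [x] injectively into [nat], in such a way that for
    each [z] the restrictions of the [h x] up to [z] are countably many. With
    distinct [m_x] in ]0, 1/4] and [b] rescaled to the unit ball, put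
    [y_x = sum_(t <= x) m_x ^ (h x t) b_t]. A functional only sees the [b_t] with
    [t] below some [z]; if it vanishes at uncountably many [y_x], then infinitely
    many of these [x] share the restriction of [h x] up to [z], and the resulting
    single power series has infinitely many zeros. *)

(** * Cardinals *)

Lemma ex_choice T U (P : T -> U -> Prop) :
  (forall x, exists y, P x y) -> exists f, forall x, P x (f x).
Proof. by move=> /choice[f]; exists f. Qed.

Lemma card_le_ex T U (A : set T) (B : set U) : B !=set0 -> A #<= B ->
  exists2 f : T -> U, set_fun A B f & set_inj A f.
Proof.
elim/Ppointed: U => U in B *; first by rewrite emptyE => -[].
by move=> _ /pcard_leP/injfunPex.
Qed.

Lemma ex_card_le T U (A : set T) (B : set U) (f : T -> U) :
  (forall x, A x -> B (f x)) ->
  (forall x y, A x -> A y -> f x = f y -> x = y) -> A #<= B.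
Proof.
move=> fAB fI; have /injfunPex[g] : exists2 g : T -> U, set_fun A B g & set_inj A g.
  by exists f => // x y; rewrite !inE; exact: fI.
exact: inj_card_le.
Qed.

Lemma surj_card_le T U (A : set T) (B : set U) (f : U -> T) :
  A `<=` f @` B -> A #<= B.
Proof. by move=> /subset_card_le/card_le_trans; apply; exact: card_image_le. Qed.

(** Zorn's lemma on the graphs of partial injections from [A] to [B]: a maximal one is defined on
    all of [A] or reaches all of [B], since otherwise a pair [(a, b)] could be added. *)
Lemma card_le_total T U (A : set T) (B : set U) : A #<= B \/ B #<= A.
Proof.
pose P (G : set (T * U)) := [/\ G `<=` A `*` B,
  forall x y y', G (x, y) -> G (x, y') -> y = y' &
  forall x x' y, G (x, y) -> G (x', y) -> x = x'].
have [F FP Ftot|G [[GAB Gf Gi] Gmax]] := @Zorn_bigcup _ P.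
  have two p q : (\bigcup_(X in F) X) p -> (\bigcup_(X in F) X) q ->
      exists2 X, F X & X p /\ X q.
    move=> [X FX Xp] [Y FY Yq]; have [XY|YX] := Ftot _ _ FX FY.
      by exists Y => //; split=> //; exact: XY.
    by exists X => //; split=> //; exact: YX.
  split=> [p [X /FP[+ _ _] Xp]|x y y' Gy Gy'|x x' y Gy Gy'].
  - exact.
  - by have [X /FP[_ + _] [Xy Xy']] := two _ _ Gy Gy'; apply; eassumption.
  - by have [X /FP[_ _ +] [Xy Xy']] := two _ _ Gy Gy'; apply; eassumption.
have [domG|/existsNP[a /not_implyP[Aa nGa]]] :=
    pselect (forall x, A x -> exists y, G (x, y)).
  left; have [->|/set0P[a Aa]] := eqVneq A set0; first exact: card_ge0.
  have [b0 _] := domG _ Aa.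
  have /ex_choice[f fG] : forall x, exists y, A x -> G (x, y).
    by move=> x; have [/domG[y]|] := pselect (A x); [exists y|by exists b0].
  apply: (@ex_card_le _ _ _ _ f) => [x /fG/GAB[]//|x y Ax Ay e].
  by apply: (Gi _ _ (f y)); [rewrite -e|]; exact: fG.
have [ranG|/existsNP[b /not_implyP[Bb nGb]]] :=
    pselect (forall y, B y -> exists x, G (x, y)).
  right; have /ex_choice[f fG] : forall y, exists x, B y -> G (x, y).
    by move=> y; have [/ranG[x]|] := pselect (B y); [exists x|by exists a].
  apply: (@ex_card_le _ _ _ _ f) => [y /fG/GAB[]//|x y Ax Ay e].
  by apply: (Gf (f x)); [|rewrite e]; exact: fG.
exfalso; apply: (Gmax (G `|` [set (a, b)])).
  split=> [p|h]; first by left.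
  by apply: nGa; exists b; apply: h; right.
split=> [p [/GAB//|->//]|x y y' []Gy []|x x' y []Gy []].
- by move=> Gy'; apply: Gf Gy Gy'.
- by move=> [xa _]; case: nGa; exists y; rewrite -xa.
- by move: Gy => [-> ->] Gy'; case: nGa; exists y'.
- by move: Gy => [-> ->] [].
- by move=> Gy'; apply: Gi Gy Gy'.
- by move=> [_ yb]; case: nGb; exists x; rewrite -yb.
- by move: Gy => [-> ->] Gy'; case: nGb; exists x'.
- by move: Gy => [-> ->] [].
Qed.

Lemma card_leX T U V W (A : set T) (B : set U) (C : set V) (D : set W) :
  A #<= C -> B #<= D -> A `*` B #<= C `*` D.
Proof.
have [->|/set0P[a Aa]] := eqVneq A set0; first by rewrite set0X => _ _; exact: card_ge0.
have [->|/set0P[b Bb]] := eqVneq B set0; first by rewrite setX0 => _ _; exact: card_ge0.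
move=> AC BD.
have ne S1 S2 (E : set S1) (F : set S2) x : E x -> E #<= F -> F !=set0.
  move=> Ex EF; apply/set0P/eqP => F0; move: EF.
  by rewrite F0 => /card_le0P E0; rewrite E0 in Ex.
have [f fC fI] := card_le_ex (ne _ _ _ _ _ Aa AC) AC.
have [g gC gI] := card_le_ex (ne _ _ _ _ _ Bb BD) BD.
apply: (@ex_card_le _ _ _ _ (fun p => (f p.1, g p.2))) => [[x y] [/= Ax By]|].
  by split; [exact: fC|exact: gC].
move=> [x y] [x' y'] [/= Ax By] [/= Ax' By'] [e1 e2].
by rewrite (fI x x') ?inE// (gI y y') ?inE.
Qed.

Lemma infinite_card_le T U (A : set T) (B : set U) :
  infinite_set A -> A #<= B -> infinite_set B.
Proof. by move=> Ai AB Bf; apply: Ai; exact: card_le_finite AB Bf. Qed.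

(** Two tags taken from a copy of [nat] inside [C] separate the two sets. The hypothesis on the
    square of [C] is explicit because the lemma is applied inside the proof of [card_le_sqr]. *)
Lemma card_leU T V (A B : set T) (C : set V) : infinite_set C ->
  C `*` C #<= C -> A #<= C -> B #<= C -> A `|` B #<= C.
Proof.
move=> Ci CC AC BC; apply: card_le_trans CC.
have C0 := infinite_setN0 Ci.
have [f fC fI] := card_le_ex C0 AC; have [g gC gI] := card_le_ex C0 BC.
have /infiniteP NC := Ci; have [e eC eI] := card_le_ex C0 NC.
apply: (@ex_card_le _ _ _ _
  (fun x => if `[< A x >] then (e 0%N, f x) else (e 1%N, g x))).
  by move=> x; case: asboolP => [Ax _|nAx [//|Bx]]; split=> /=;
    [exact: eC|exact: fC|exact: eC|exact: gC].
move=> x y ABx ABy; case: asboolP => Ax; case: asboolP => Ay [].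
- by move=> /fI; rewrite !inE; exact.
- by move=> /eI; rewrite !inE => /(_ I I).
- by move=> /eI; rewrite !inE => /(_ I I).
- move=> /gI; case: ABx => // Bx; case: ABy => // By.
  by rewrite !inE; exact.
Qed.

(** Take a maximal injection of the square of an infinite base into that base. If the rest of [A] is
    no larger than the base, the base is as large as [A]. Otherwise the rest contains a copy [S'] of
    the base, and sending the new pairs over the union [U] into [S'] extends the injection. *)
Lemma card_le_sqr T (A : set T) : infinite_set A -> A `*` A #<= A.
Proof.
move=> Ai.
(* The base of a graph is read off the diagonal of its domain; [good] says that [G] is an injection
   of the square of its base into the base. *)
pose S (G : set (T * T * T)) : set T := [set x | exists z, G (x, x, z)].
pose good (G : set (T * T * T)) := [/\ S G `<=` A,
  forall x y, S G x -> S G y -> exists z, G (x, y, z),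
  forall x y z, G (x, y, z) -> [/\ S G x, S G y & S G z],
  forall p z z', G (p, z) -> G (p, z') -> z = z' &
  forall p p' z, G (p, z) -> G (p', z) -> p = p'].
have [G0 gG0 iG0] : exists2 G0, good G0 & infinite_set (S G0).
  have /infiniteP/card_le_ex[|e eA eI] := Ai; first exact: infinite_setN0.
  have /card_eqPle[N2 _] := card_nat2.
  have {N2} [q _ qI] := card_le_ex (ex_intro _ 0%N I) N2.
  have {}eI x y : e x = e y -> x = y by move=> /eI; rewrite !inE; exact.
  have {}qI x y : q x = q y -> x = y by move=> /qI; rewrite !inE; exact.
  pose G0 : set (T * T * T) :=
    [set t | exists m n, t = (e m, e n, e (q (m, n)))].
  have SG0 : S G0 = range e.
    apply/seteqP; split=> [x [z [m [n [-> _ _]]]]|_ [n _ <-]]; first by exists m.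
    by exists (e (q (n, n))); exists n, n.
  exists G0.
    rewrite /good SG0; split.
    - by move=> _ [n _ <-]; exact: eA.
    - by move=> _ _ [m _ <-] [n _ <-]; exists (e (q (m, n))); exists m, n.
    - by move=> x y z [m [n [-> -> ->]]]; split; eexists.
    - move=> _ _ _ [m [n [-> ->]]] [m' [n' [/eI mm' /eI nn' ->]]].
      by rewrite mm' nn'.
    - move=> _ _ _ [m [n [-> ->]]] [m' [n' [-> /eI/qI[-> ->]]]].
      by [].
  rewrite SG0; apply/infiniteP; apply: (@ex_card_le _ _ _ _ e) => [x _|x y _ _].
    by exists x.
  exact: eI.
(* Zorn's lemma runs over what is added to [G0]: the union over the empty chain is then still good,
   and the base stays infinite. *)
pose P X := good (G0 `|` X).
have [F FP Ftot|X [gX Xmax]] := @Zorn_bigcup _ P.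
  have [->|/set0P[X0 FX0]] := eqVneq F set0.
    by rewrite bigcup_set0 /P setU0.
  have two p q : (G0 `|` \bigcup_(X in F) X) p -> (G0 `|` \bigcup_(X in F) X) q ->
      exists2 X, F X & (G0 `|` X) p /\ (G0 `|` X) q.
    move=> [G0p|[X FX Xp]] [G0q|[Y FY Yq]].
    - by exists X0 => //; split; left.
    - by exists Y => //; split; [left|right].
    - by exists X => //; split; [right|left].
    have [XY|YX] := Ftot _ _ FX FY.
      by exists Y => //; split; right=> //; exact: XY.
    by exists X => //; split; right=> //; exact: YX.
  have sub X : F X -> G0 `|` X `<=` G0 `|` \bigcup_(X in F) X.
    by move=> FX x [|Xx]; [left|right; exists X].
  have subS X : F X -> S (G0 `|` X) `<=` S (G0 `|` \bigcup_(X in F) X).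
    by move=> FX x [z /(sub _ FX) ?]; exists z.
  split.
  - move=> x [z Gz]; have [X /FP[XA _ _ _ _] [Xz _]] := two _ _ Gz Gz.
    by apply: XA; exists z.
  - move=> x y [z Gz] [t Gt]; have [X FX [Xz Xt]] := two _ _ Gz Gt.
    have [_ Xd _ _ _] := FP _ FX.
    have [||u Xu] := Xd x y; [by exists z|by exists t|].
    by exists u; exact: (sub _ FX).
  - move=> x y z Gz; have [X FX [Xz _]] := two _ _ Gz Gz.
    have [_ _ XS _ _] := FP _ FX; have [? ? ?] := XS _ _ _ Xz.
    by split; exact: (subS _ FX).
  - move=> p z z' Gz Gz'; have [X FX [Xz Xz']] := two _ _ Gz Gz'.
    by have [_ _ _ Xf _] := FP _ FX; exact: Xf Xz Xz'.
  - move=> p p' z Gz Gz'; have [X FX [Xz Xz']] := two _ _ Gz Gz'.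
    by have [_ _ _ _ Xf] := FP _ FX; exact: Xf Xz Xz'.
set G := G0 `|` X in gX; have [GA Gd GS Gf Gi] := gX.
have Si : infinite_set (S G).
  by apply: sub_infinite_set iG0 => x [z ?]; exists z; left.
have [a0 Sa0] := infinite_setN0 Si.
have SS : S G `*` S G #<= S G.
  have /ex_choice[p pG] : forall xy, exists z, (S G `*` S G) xy -> G (xy, z).
    move=> -[x y]; have [[/= Sx Sy]|] := pselect ((S G `*` S G) (x, y)).
      by have [z Gz] := Gd _ _ Sx Sy; exists z.
    by exists a0.
  apply: (@ex_card_le _ _ _ _ p) => [[x y] /pG/GS[]//|p1 p2 h1 h2 e].
  by apply: (Gi _ _ (p p1)); [|rewrite e]; exact: pG.
have [|SAS] := card_le_total (A `\` S G) (S G).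
  move=> AS; have {}AS : A #<= S G.
    apply: (@card_le_trans _ _ _ (S G `|` (A `\` S G))).
      by apply: subset_card_le => x Ax; have [|] := pselect (S G x); [left|right].
    by apply: card_leU.
  apply: card_le_trans (card_leX AS AS) _; apply: card_le_trans SS _.
  exact: subset_card_le.
have [f fA fI] := card_le_ex (infinite_setN0 (infinite_card_le Si SAS)) SAS.
pose S' := f @` S G; pose U := S G `|` S'.
have US : U #<= S G by apply: card_leU => //; exact: card_image_le.
have [k kS kI] : exists2 k, set_fun (U `*` U) S' k & set_inj (U `*` U) k.
  apply: card_le_ex; first by exists (f a0); exists a0.
  apply: card_le_trans (card_leX US US) _; apply: card_le_trans SS _.
  apply: (@ex_card_le _ _ _ _ f) => [x Sx|x y Sx Sy /fI]; first by exists x.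
  by rewrite !inE; exact.
have S'S x : S' x -> ~ S G x by move=> [y /fA[] _ nS <-].
pose H : set (T * T * T) :=
  [set t | [/\ (U `*` U) t.1, ~ (S G `*` S G) t.1 & t.2 = k t.1]].
have GH : G0 `|` (X `|` H) = G `|` H by rewrite setUA.
have fa0 : S' (f a0) by exists a0.
have SGH : S (G `|` H) = U.
  apply/seteqP; split=> x; first by move=> [z [Gz|[[] //]]]; left; exists z.
  move=> [[z Gz]|S'x]; first by exists z; left.
  by exists (k (x, x)); right; split=> //=; [split; right|move=> [/= + _]; exact: S'S].
exfalso; apply: (Xmax (X `|` H)).
  split=> [x Xx|h]; first by left.
  apply: (S'S _ fa0); have : G (f a0, f a0, k (f a0, f a0)).
    by right; apply: h; right; split=> //=; [split; right|move=> [/= + _]; exact: S'S].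
  by case/GS.
rewrite /P GH /good SGH; split.
- by move=> x [/GA//|[y /fA[] ? _ <-]].
- move=> x y Ux Uy; have [[/= Sx Sy]|nS] := pselect ((S G `*` S G) (x, y)).
    by have [z Gz] := Gd _ _ Sx Sy; exists z; left.
  by exists (k (x, y)); right.
- move=> x y z [/GS[? ? ?]|[[/= Ux Uy] nS /= ->]]; first by split; left.
  by split=> //; right; apply: kS.
- move=> [x y] z z' [Gz|[_ nS /= ->]] [Gz'|[_ nS' /= ->]] //.
  + exact: Gf Gz Gz'.
  + by case: nS'; have [? ? _] := GS _ _ _ Gz.
  + by case: nS; have [? ? _] := GS _ _ _ Gz'.
- move=> [x y] [x' y'] z [Gz|[Up _ /= zp]] [Gz'|[Uq _ /= zq]].
  + exact: Gi Gz Gz'.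
  + have [_ _] := GS _ _ _ Gz; rewrite zq /= => h; exfalso.
    by apply: S'S h; exact: kS.
  + have [_ _] := GS _ _ _ Gz'; rewrite zp /= => h; exfalso.
    by apply: S'S h; exact: kS.
  + by apply: kI; rewrite ?inE// -zp.
Qed.

Lemma card_bigcup_le I T U (K : set I) (F : I -> set T) (B : set U) :
  infinite_set B -> K #<= B -> (forall i, K i -> F i #<= B) ->
  \bigcup_(i in K) F i #<= B.
Proof.
move=> Bi KB FB; apply: card_le_trans (card_le_sqr Bi).
have B0 := infinite_setN0 Bi; have [b Bb] := B0.
have [->|/set0P[i0 Ki0]] := eqVneq K set0; first by rewrite bigcup_set0; exact: card_ge0.
have [j jB jI] := card_le_ex B0 KB.
have /ex_choice[f fP] : forall i, exists g : T -> U, K i ->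
    set_fun (F i) B g /\ set_inj (F i) g.
  move=> i; have [/FB/(card_le_ex B0)[f]|] := pselect (K i); first by exists f.
  by exists (fun=> b).
have /ex_choice[c cP] : forall x, exists i, (\bigcup_(i in K) F i) x ->
    K i /\ F i x.
  move=> x; have [[i Ki Fx]|] := pselect ((\bigcup_(i in K) F i) x).
    by exists i.
  by exists i0.
apply: (@ex_card_le _ _ _ _ (fun x => (j (c x), f (c x) x))).
  by move=> x /cP[Kc Fc]; split=> /=; [exact: jB|exact: (fP _ Kc).1].
move=> x y /cP[Kx Fx] /cP[Ky Fy] [/jI]; rewrite !inE => /(_ Kx Ky) cxy.
rewrite cxy in Kx Fx *.
by move=> /(fP _ Ky).2; rewrite !inE; exact.
Qed.

Lemma card_seq_le (T : choiceType) U (A : set T) (B : set U) :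
  infinite_set B -> A #<= B ->
  [set s : seq T | forall x, x \in s -> A x] #<= B.
Proof.
move=> Bi AB; set L := [set s | _].
have -> : L = \bigcup_n [set s | L s /\ size s = n].
  by apply/seteqP; split=> [s Ls|s [n _ []//]]; exists (size s).
apply: card_bigcup_le => //; first exact/infiniteP.
elim=> [_|n /(_ I) IH _].
  apply: card_le_trans (subset_card_le (_ : _ `<=` [set [::]])) _.
    by move=> s [_ /size0nil].
  have [b Bb] := infinite_setN0 Bi.
  by apply: (@ex_card_le _ _ _ _ (fun=> b)) => // x y -> ->.
apply: card_le_trans (card_le_sqr Bi); apply: card_le_trans (card_leX AB IH).
apply: (@surj_card_le _ _ _ _ (fun p => p.1 :: p.2)) => -[|x s] [Ls //= [ss]].
exists (x, s) => //; split=> /=; first by apply: Ls; rewrite mem_head.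
by split=> // y ys; apply: Ls; rewrite inE ys orbT.
Qed.

(** * Well-orders and the first uncountable ordinal *)

Definition strict_wo T (R : T -> T -> Prop) := [/\
  forall x y z, R x y -> R y z -> R x z,
  forall x y, [\/ R x y, x = y | R y x] &
  forall A : set T, A !=set0 -> exists2 m, A m & forall x, A x -> ~ R x m].

Lemma strict_wo_irr T (R : T -> T -> Prop) x : strict_wo R -> ~ R x x.
Proof. by case=> _ _ /(_ [set x])[|m -> h Rx]; [exists x|exact: (h x)]. Qed.

Lemma wo_chain_strict (T : eqType) (r : rel T) (C : pred T) :
  let S x y := [/\ x \in C, y \in C, x != y & r x y] in
  wochoice.wo_chain r C -> [/\
  forall x y z, S x y -> S y z -> S x z,
  forall x y, x \in C -> y \in C -> [\/ S x y, x = y | S y x] &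
  forall A : set T, A !=set0 -> exists2 m, A m & forall x, A x -> ~ S x m].
Proof.
move=> S Cwo; have tot := wochoice.wo_chainW Cwo.
have anti := wochoice.wo_chain_antisymmetric Cwo.
split.
- move=> x y z [Cx Cy xy rxy] [_ Cz yz ryz].
  have xz : x != z.
    apply: contraNneq xy => xz; rewrite -xz in ryz.
    by apply/eqP/anti => //; rewrite rxy ryz.
  split=> //.
  (* Transitivity is read off the least element of [{x, y, z}]: antisymmetry rules out [y] and
     [z]. *)
  have [||m [[Am mP] _]] := Cwo [pred t | t \in [:: x; y; z]].
  + by move=> t; rewrite !inE => /or3P[] /eqP->.
  + by exists x; rewrite !inE eqxx.
  have mx : r m x by apply: mP; rewrite !inE eqxx.
  have my : r m y by apply: mP; rewrite !inE eqxx orbT.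
  have mz : r m z by apply: mP; rewrite !inE eqxx !orbT.
  move: Am; rewrite !inE => /or3P[] /eqP e; subst m => //.
  + by move: xy; rewrite (anti x y) ?eqxx// rxy mx.
  + by move: yz; rewrite (anti y z) ?eqxx// ryz my.
- move=> x y Cx Cy; have [->|xy] := eqVneq x y; first exact: Or32.
  have := tot x y Cx Cy; case/orP => r_; first exact: Or31.
  by apply: Or33; split=> //; rewrite eq_sym.
- move=> A [a Aa]; have [[b [Ab Cb]]|nAC] := pselect (exists b, A b /\ b \in C).
    have [||m [[]]] := Cwo [pred t | `[< A t >] && (t \in C)].
    + by move=> t; rewrite inE => /andP[].
    + by exists b; rewrite inE; apply/andP; split=> //; exact/asboolP.
    rewrite inE => /andP[/asboolP Am Cm] mP _.
    exists m => // x Ax [Cx _ xm rxm]; move/eqP: xm; apply; apply: anti => //.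
    by rewrite rxm mP// inE Cx andbT; exact/asboolP.
  by exists a => // x Ax [Cx _ _ _]; apply: nAC; exists x.
Qed.

Lemma ex_strict_wo T : exists R : T -> T -> Prop, strict_wo R.
Proof.
elim/Peq: T => T; have [r rwo] := wochoice.well_ordering_principle T.
have [|tr tri mn] := @wo_chain_strict T r predT; first by move=> A _; exact: rwo.
by eexists; split; [exact: tr|move=> x y; exact: tri|exact: mn].
Qed.

Lemma wf_fixpoint T U (S : T -> T -> Prop) (G : T -> (T -> U) -> U) :
  (forall A : set T, A !=set0 -> exists2 m, A m & forall x, A x -> ~ S x m) ->
  (forall x f g, (forall y, S y x -> f y = g y) -> G x f = G x g) -> U ->
  exists phi, forall x, phi x = G x phi.
Proof.
move=> mn ext u.
have wfS : well_founded S.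
  move=> x; apply: contrapT => nx.
  have [|m nm h] := mn [set x | ~ Acc S x]; first by exists x.
  by apply: nm; constructor => y Sy; apply: contrapT => /h.
(* The recursion only knows the values below [x]; [u] fills in the others, to which [G x] is blind
   by [ext]. *)
pose F x (rec : forall y, S y x -> U) :=
  G x (fun y => if pselect (S y x) is left h then rec y h else u).
exists (Fix wfS _ F) => x; rewrite Fix_eq => [|{}x f g fg].
  by apply: ext => y Syx; case: pselect.
by apply: ext => y Syx; case: pselect.
Qed.

Definition initseg T (R : T -> T -> Prop) (C : set T) x := [set y | C y /\ R y x].

(* C has order type at most omega_1. *)
Definition cseg T (R : T -> T -> Prop) (C : set T) :=
  forall x, C x -> countable (initseg R C x).

(** By transfinite recursion, [phi x] is chosen in [B] outside the countably many values already
    taken. *)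
Lemma cseg_card_le T U (R : T -> T -> Prop) (C : set T) (B : set U) :
  strict_wo R -> cseg R C -> ~ countable B -> C #<= B.
Proof.
move=> [_ tri mn] Cseg Bu.
have /ex_choice[pick pickP] : forall E, exists b, countable E -> B b /\ ~ E b.
  move=> E; have [Ec|] := pselect (countable E); last first.
    have [->|/set0P[b _]] := eqVneq B set0; last by exists b.
    by have [b _] : B !=set0; [apply/set0P/eqP => B0; apply: Bu; rewrite B0|exists b].
  have [b [Bb Eb]] : (B `\` E) !=set0.
    apply/set0P/eqP => BE; apply: Bu; apply: sub_countable Ec.
    by apply: subset_card_le; rewrite -setD_eq0.
  by exists b.
have [|||phi phiE] := @wf_fixpoint T U R
    (fun x f => pick (f @` initseg R C x)).
- exact: mn.
- move=> x f g fg; congr pick.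
  by apply/seteqP; split=> _ [y [Cy Ry] <-]; exists y; rewrite ?fg.
- exact: (pick set0).
have phiP x : C x -> B (phi x) /\ ~ (phi @` initseg R C x) (phi x).
  move=> Cx; rewrite phiE; apply: pickP; apply: sub_countable (Cseg _ Cx).
  exact: card_image_le.
apply: (@ex_card_le _ _ _ _ phi) => [x /phiP[]//|x y Cx Cy e].
have [Rxy|//|Ryx] := tri x y.
- by case: (phiP _ Cy).2; exists x.
- by case: (phiP _ Cx).2; exists y.
Qed.

(** Cut [A] at the least element with uncountably many predecessors, if there is one. *)
Lemma ex_cseg T (R : T -> T -> Prop) (A : set T) : strict_wo R -> ~ countable A ->
  exists W, [/\ W `<=` A, ~ countable W & cseg R W].
Proof.
move=> [_ _ mn] Au.
have [cA|/existsNP[x /not_implyP[Ax nx]]] := pselect (cseg R A); first by exists A; split.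
have [|m [Am nm] mP] := mn [set x | A x /\ ~ countable (initseg R A x)].
  by exists x.
exists (initseg R A m); split=> [y []//|//|y [Ay Rym]].
apply: contrapT => ny; apply: (mP y) => //; split=> // cy; apply: ny.
by apply: sub_countable cy; apply: subset_card_le => z [[]].
Qed.

(** Since [P] preserves and reflects the orders, antisymmetry makes it single-valued and injective,
    so any choice function for it is an isomorphism. *)
Lemma wo_iso_of_rel (w w' : pred nat * rel nat) (P : nat -> nat -> Prop) :
  is_wo w -> is_wo w' ->
  (forall m, m \in w.1 -> exists2 n, n \in w'.1 & P m n) ->
  (forall n, n \in w'.1 -> exists2 m, m \in w.1 & P m n) ->
  (forall m m' n n', m \in w.1 -> m' \in w.1 -> n \in w'.1 -> n' \in w'.1 ->
     P m n -> P m' n' -> w'.2 n n' = w.2 m m') ->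
  wo_iso w w'.
Proof.
move=> wwo wwo' tot1 tot2 mono.
have refl := wochoice.wo_chain_reflexive wwo.
have refl' := wochoice.wo_chain_reflexive wwo'.
have anti := wochoice.wo_chain_antisymmetric wwo.
have anti' := wochoice.wo_chain_antisymmetric wwo'.
have /ex_choice[f fP] : forall m, exists n, m \in w.1 -> n \in w'.1 /\ P m n.
  by move=> m; case: (boolP (m \in w.1)) => [/tot1[n]|_]; [exists n|exists 0%N].
exists f; split; last by move=> x y xw yw; apply: mono => //; case: (fP x); case: (fP y).
split.
- by move=> m /= mw; case: (fP m).
- move=> x y; rewrite !inE /= => xw yw e.
  have [xf Px] := fP x xw; have [yf Py] := fP y yw; apply: anti => //.
  by rewrite -(mono x y _ _ xw yw xf yf)// -(mono y x _ _ yw xw yf xf)// e refl'.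
- move=> n /= nw; have [m mw Pmn] := tot2 n nw; exists m => //.
  have [fw Pf] := fP m mw; apply: anti' => //.
  by rewrite (mono m m)// (mono m m)// refl.
Qed.

Lemma wo_iso_refl w : wo_iso w w.
Proof. by exists id; split=> //; split=> [//|x y _ _|x wx] //; exists x. Qed.

Lemma wo_iso_euclidean w w' w'' : is_wo w -> is_wo w' -> is_wo w'' ->
  wo_iso w w' -> wo_iso w w'' -> wo_iso w' w''.
Proof.
move=> wo0 wo1 wo2 [f [[fF fI fS] fM]] [g [[gF gI gS] gM]].
apply: (@wo_iso_of_rel _ _ (fun m n => exists2 k, k \in w.1 & f k = m /\ g k = n)) => //.
- by move=> m /fS[k kw <-]; exists (g k); [exact: gF|exists k].
- by move=> n /gS[k kw <-]; exists (f k); [exact: fF|exists k].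
- move=> _ _ _ _ _ _ _ _ [k kw [<- <-]] [k' kw' [<- <-]].
  by rewrite gM// fM.
Qed.

Lemma omega1_eq w w' : is_wo w -> is_wo w' -> wo_iso w w' ->
  [set v | is_wo v /\ wo_iso w v] = [set v | is_wo v /\ wo_iso w' v].
Proof.
move=> wo wo' i; apply/seteqP; split=> v [wov iv]; split=> //.
  exact: wo_iso_euclidean i iv.
apply: wo_iso_euclidean iv => //; apply: wo_iso_euclidean i _ => //.
exact: wo_iso_refl.
Qed.

(** Each countable well-order [w] is mapped by [phi w] onto a proper initial segment of [W], always
    taking the least element not yet used. The class of [w] is sent to [i w], the first element past
    this segment; equal ends mean equal segments, hence isomorphic orders. *)
Lemma omega1_le_cseg T (R : T -> T -> Prop) (W : set T) : strict_wo R ->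
  ~ countable W -> cseg R W -> omega1 #<= W.
Proof.
move=> Rwo Wu Wseg; have [tr tri mn] := Rwo.
have /ex_choice[pick pickP] : forall E : set T, exists b, countable E ->
    [/\ W b, ~ E b & forall v, W v -> R v b -> E v].
  move=> E; have [Ec|] := pselect (countable E); last first.
    by have [b _] : W !=set0; [apply/set0P/eqP => B0; apply: Wu; rewrite B0|exists b].
  have [|b [Wb nEb] bP] := mn (W `\` E).
    apply/set0P/eqP => WE; apply: Wu; apply: sub_countable Ec.
    by apply: subset_card_le; rewrite -setD_eq0.
  exists b; split=> // v Wv Rvb; apply: contrapT => nEv.
  exact: (bP v).
pose S (w : pred nat * rel nat) x y := [/\ x \in w.1, y \in w.1, x != y & w.2 x y].
have /ex_choice[phi phiP] : forall w, exists phi, is_wo w ->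
    forall n, phi n = pick (phi @` [set m | S w m n]).
  move=> w; have [wo|] := pselect (is_wo w); last by exists (fun=> pick set0).
  have [_ _ Smn] := wo_chain_strict wo.
  have [//|||phi phiE] := @wf_fixpoint _ T (S w)
    (fun x f => pick (f @` [set m | S w m x])).
  - move=> x f g fg; congr pick; apply/seteqP; split=> _ [y Sy <-]; by exists y; rewrite ?fg.
  - exact: (pick set0).
  by exists phi.
have cnat (E : set nat) (f : nat -> T) : countable (f @` E).
  by apply: sub_countable (card_image_le f E) _; exact: countableP.
have phi1 w n : is_wo w -> [/\ W (phi w n), ~ (phi w @` [set m | S w m n]) (phi w n)
    & forall v, W v -> R v (phi w n) -> (phi w @` [set m | S w m n]) v].
  by move=> /phiP ->; exact: pickP.
have phiM w m n : is_wo w -> S w m n -> R (phi w m) (phi w n).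
  move=> wo Smn; have [Str _ _] := wo_chain_strict wo.
  have [Wm _ hm] := phi1 w m wo; have [Wn nE hn] := phi1 w n wo.
  have [//|e|Rnm] := tri (phi w m) (phi w n).
    by case: nE; exists m.
  have [k Skm kE] := hm _ Wn Rnm.
  by case: nE; exists k => //; exact: (Str k m n).
have phi2 w m n : is_wo w -> m \in w.1 -> n \in w.1 ->
    w.2 m n = `[< phi w m = phi w n \/ R (phi w m) (phi w n) >].
  move=> wo mw nw; have [_ Stri _] := wo_chain_strict wo.
  have [Smn|->|Snm] := Stri m n mw nw.
  - have [_ _ _ ->] := Smn; symmetry; apply/asboolP; right; exact: phiM.
  - rewrite (wochoice.wo_chain_reflexive wo)//; symmetry; apply/asboolP; by left.
  - have Rnm := phiM _ _ _ wo Snm; apply/idP/asboolP.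
      have [_ _ nm rnm] := Snm => rmn.
      by move: nm; rewrite (wochoice.wo_chain_antisymmetric wo mw nw) ?eqxx ?rmn.
    move=> [e|Rmn]; first by case: (@strict_wo_irr _ R (phi w n) Rwo); rewrite -{2}e.
    by case: (@strict_wo_irr _ R (phi w n) Rwo); apply: tr Rnm Rmn.
pose i w := pick (phi w @` [set n | n \in w.1]).
have iP w : is_wo w -> W (i w) /\ forall v, W v ->
    ((phi w @` [set n | n \in w.1]) v <-> R v (i w)).
  move=> wo; have [Wi ni hi] := pickP _ (cnat [set n | n \in w.1] (phi w)).
  split=> // v Wv; split=> [[n /= nw nv]|]; last exact: hi.
  have [//|vi|Riv] := tri v (i w); first by case: ni; exists n => //; rewrite nv.
  rewrite -nv in Riv; have [_ _ hn] := phi1 w n wo.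
  by have [k [kw _ _ _] ki] := hn _ Wi Riv; case: ni; exists k.
have /ex_choice[c cP] : forall a, exists w, omega1 a ->
    is_wo w /\ a = [set w' | is_wo w' /\ wo_iso w w'].
  move=> a; have [[w wo aE]|] := pselect (omega1 a); first by exists w.
  by exists (pred0 : pred nat, (fun _ _ => true) : rel nat).
apply: (@ex_card_le _ _ _ _ (i \o c)) => [a /cP[/iP[]]//|a b ha hb /= e].
have [woa aE] := cP _ ha; have [wob bE] := cP _ hb.
rewrite aE bE; apply: omega1_eq => //.
have [_ ia] := iP _ woa; have [_ ib] := iP _ wob.
apply: (@wo_iso_of_rel _ _ (fun m n => phi (c a) m = phi (c b) n)) => //.
- move=> m mw; have [Wm _ _] := phi1 (c a) m woa.
  have [|n nw <-] := (ib _ Wm).2; last by exists n.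
  by rewrite -e; apply/(ia _ Wm); exists m.
- move=> n nw; have [Wn _ _] := phi1 (c b) n wob.
  have [|m mw <-] := (ia _ Wn).2; last by exists m.
  by rewrite e; apply/(ib _ Wn); exists n.
- by move=> m m' n n' mw mw' nw nw' e1 e2; rewrite !phi2// e1 e2.
Qed.

(** Send [x] to the order type of its initial segment, carried over to [nat] by an injection [g x].
    This is injective because a well-order is not isomorphic to a proper initial segment of
    itself. *)
Lemma cseg_le_omega1 T (R : T -> T -> Prop) (C : set T) :
  strict_wo R -> cseg R C -> C #<= omega1.
Proof.
move=> Rwo Cseg; have [tr tri mn] := Rwo; have irr x := @strict_wo_irr _ R x Rwo.
have /ex_choice[g gI] : forall x, exists g : T -> nat, C x -> set_inj (initseg R C x) g.
  move=> x; have [/Cseg/countable_injP[g]|] := pselect (C x); first by exists g.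
  by exists (fun=> 0%N).
pose seg := initseg R C.
pose w x : pred nat * rel nat := ((fun m => `[< (g x @` seg x) m >]),
  (fun m n => `[< exists y z, [/\ seg x y, seg x z, g x y = m, g x z = n &
                 y = z \/ R y z] >])).
have wE x y z : C x -> seg x y -> seg x z ->
    (w x).2 (g x y) (g x z) <-> y = z \/ R y z.
  move=> Cx sy sz; split=> [/asboolP[y' [z' [sy' sz' ey ez]]]|h].
    have ey' : y' = y by apply: (gI x Cx) => //; rewrite inE.
    have ez' : z' = z by apply: (gI x Cx) => //; rewrite inE.
    by rewrite -ey' -ez'.
  by apply/asboolP; exists y, z.
have wwo x : C x -> is_wo (w x).
  move=> Cx; apply: wochoice.antisymmetric_wo_chain.
    move=> m n /asboolP[y sy <-] /asboolP[z sz <-] /andP[].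
    move=> /(wE _ _ _ Cx sy sz)[->//|Ryz] /(wE _ _ _ Cx sz sy)[->//|Rzy].
    by case: (irr y); exact: tr Ryz Rzy.
  move=> A AC [m0 Am0].
  have [|y [sy Ay] yP] := mn [set y | seg x y /\ g x y \in A].
    by have /asboolP[y sy ym] := AC _ Am0; exists y; split=> //; rewrite ym.
  exists (g x y); split=> // n An; have /asboolP[z sz zn] := AC _ An; rewrite -zn in An *.
  apply/(wE _ _ _ Cx sy sz); have [|->|Rzy] := tri y z; [by right|by left|].
  by case: (yP z).
have key x x' : C x -> C x' -> R x x' -> ~ wo_iso (w x') (w x).
  move=> Cx Cx' Rxx' [f [[fF fI _] fM]].
  have /ex_choice[k kP] : forall y, exists z, seg x' y -> seg x z /\ g x z = f (g x' y).
    move=> y; have [sy|] := pselect (seg x' y); last by exists x.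
    have : (w x').1 (g x' y) by apply/asboolP; exists y.
    by move=> /fF/asboolP[z sz zE]; exists z.
  have kM y z : seg x' y -> seg x' z -> R y z -> R (k y) (k z).
    move=> sy sz Ryz; have [sky kyE] := kP y sy; have [skz kzE] := kP z sz.
    have wy : g x' y \in (w x').1 by apply/asboolP; exists y.
    have wz : g x' z \in (w x').1 by apply/asboolP; exists z.
    have := fM _ _ wy wz; rewrite -kyE -kzE => wM.
    have /(wE _ _ _ Cx sky skz)[e|//] : (w x).2 (g x (k y)) (g x (k z)).
      by rewrite wM; apply/(wE _ _ _ Cx' sy sz); right.
    have : g x' y = g x' z.
      by apply: fI; rewrite ?inE//; rewrite -kyE -kzE e.
    by move=> /(gI x' Cx'); rewrite !inE => /(_ sy sz) yz; case: (irr y); rewrite {2}yz.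
  have sx : seg x' x by split.
  (* The monotone map [k] lowers [x]. If [m] is the least point that it lowers, then [k m] is a
     smaller one. *)
  have [|m [sm km] mP] := mn [set z | seg x' z /\ R (k z) z].
    by exists x; split=> //; have [[]] := kP x sx.
  have [[Ckm Rkm] _] := kP m sm.
  have skm : seg x' (k m) by split=> //; exact: tr Rkm Rxx'.
  by apply: (mP (k m)) => //; split=> //; exact: kM.
apply: (@ex_card_le _ _ _ _ (fun x => [set v | is_wo v /\ wo_iso (w x) v])).
  by move=> x Cx; exists (w x) => //; exact: wwo.
move=> x y Cx Cy e.
have xy : wo_iso (w x) (w y).
  have : [set v | is_wo v /\ wo_iso (w y) v] (w y).
    by split; [exact: wwo|exact: wo_iso_refl].
  by rewrite -e => -[].
have yx : wo_iso (w y) (w x).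
  have : [set v | is_wo v /\ wo_iso (w x) v] (w x).
    by split; [exact: wwo|exact: wo_iso_refl].
  by rewrite e => -[].
by have [/key|//|/key] := tri x y => /(_ _ _)[].
Qed.

Lemma infinite_omega1 : infinite_set omega1.
Proof.
apply/infiniteP; apply: (@cseg_le_omega1 _ (fun m n => m < n)%N); last first.
  by move=> n _; exact: countableP.
split=> [x y z|x y|A [a Aa]]; first exact: ltn_trans.
  by case: (ltngtP x y) => h; [constructor 1|constructor 3|constructor 2].
have ex : exists n, `[< A n >] by exists a; exact/asboolP.
case: (ex_minnP ex) => m /asboolP Am mP; exists m => // x Ax.
have /mP : `[< A x >] by exact/asboolP.
by rewrite leqNgt => /negP.
Qed.

Lemma countable_le_omega1 T (A : set T) : countable A -> A #<= omega1.
Proof. by move=> /card_le_trans; apply; apply/infiniteP; exact: infinite_omega1. Qed.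

(** * Coherent injections into nat *)

Definition closed_seg T (R : T -> T -> Prop) (C : set T) x :=
  [set y | C y /\ (R y x \/ y = x)].

Lemma countable_closed_seg T (R : T -> T -> Prop) (C : set T) x :
  cseg R C -> C x -> countable (closed_seg R C x).
Proof.
move=> Cseg Cx; apply: (@sub_countable _ _ _ (initseg R C x `|` [set x])).
  by apply: subset_card_le => y [Cy [Ryx|->]]; [left|right].
by rewrite -bigcup2E; apply: bigcup_countable => // -[|[|n]] _ //=; exact: Cseg.
Qed.

(* With [c x n] enumerating the elements below [x], and [n] the least index such
   that [y <= c x n], the recursion is [a x y = maxn n (a (c x n) y)]: the [maxn]
   keeps [a x] finite-to-one, and finite-to-one-ness of the [a (c x n)] makes it
   differ from them at finitely many places only. *)
Lemma coherent_finite_to_one T (R : T -> T -> Prop) (W : set T) :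
  strict_wo R -> cseg R W -> exists a : T -> T -> nat,
  [/\ forall x n, W x -> finite_set [set y | closed_seg R W x y /\ (a x y <= n)%N] &
      forall x z, W x -> W z -> R z x ->
        finite_set [set y | closed_seg R W z y /\ a x y <> a z y]].
Proof.
move=> Rwo Wseg; have [tr tri mn] := Rwo.
have /ex_choice[c cP] : forall x, exists c : nat -> T, W x ->
    initseg R W x !=set0 -> initseg R W x = range c.
  move=> x; have [/Wseg/pfcard_geP[->|/surjfunPex[f fE]]|] := pselect (W x).
  - by exists (fun=> x) => _ [].
  - by exists f.
  - by exists (fun=> x).
have cseg_ x n : W x -> initseg R W x !=set0 -> initseg R W x (c x n).
  by move=> Wx /cP ->//; exists n.
have /ex_choice[nn nnP] : forall xy : T * T, exists n,
    W xy.1 -> initseg R W xy.1 xy.2 -> closed_seg R W (c xy.1 n) xy.2 /\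
    forall m, closed_seg R W (c xy.1 m) xy.2 -> (n <= m)%N.
  move=> [x y] /=; have [[Wx sxy]|h] := pselect (W x /\ initseg R W x y); last first.
    by exists 0%N => Wx sxy; case: h.
  have ex : exists n, `[< closed_seg R W (c x n) y >].
    have : (range (c x)) y by rewrite -cP//; exists y.
    case=> n _ <-; exists n; apply/asboolP; split; last by right.
    by case: (cseg_ x n Wx) => //; exists y.
  case: (ex_minnP ex) => m /asboolP cm mP; exists m => _ _; split=> // k ck.
  by apply: mP; exact/asboolP.
have [|||a aE] := @wf_fixpoint T (T -> nat) R (fun x f y =>
    if `[< W x /\ initseg R W x y >] then maxn (nn (x, y)) (f (c x (nn (x, y))) y)
    else 0%N).
- exact: mn.
- move=> x f g fg; apply/funext => y; case: asboolP => // -[Wx sxy].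
  by rewrite fg//; case: (cseg_ x (nn (x, y)) Wx) => //; exists y.
- by move=> _; exact: 0%N.
have {}aE x y : W x -> initseg R W x y ->
    a x y = maxn (nn (x, y)) (a (c x (nn (x, y))) y).
  by move=> Wx sxy; rewrite {1}aE; case: asboolP => // -[].
exists a; pose Q x := W x -> (forall n, finite_set
    [set y | closed_seg R W x y /\ (a x y <= n)%N]) /\
  forall z, W z -> R z x -> finite_set [set y | closed_seg R W z y /\ a x y <> a z y].
suff QT x : Q x by split=> [x n Wx|x z Wx]; [exact: (QT x Wx).1|exact: (QT x Wx).2].
apply: contrapT => nQ.
have [|m nQm mP] := mn [set x | ~ Q x]; first by exists x.
have {mP}IH y : R y m -> Q y by move=> Rym; apply: contrapT => /mP.
apply: nQm => Wm; split=> [n|z Wz Rzm].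
  apply: (@sub_finite_set _ _ ([set m] `|` \bigcup_(k in `I_n.+1)
      [set y | initseg R W m (c m k) /\
        (closed_seg R W (c m k) y /\ (a (c m k) y <= n)%N)])).
    move=> y [[Wy [Rym|->]] an]; last by left.
    have smy : initseg R W m y by [].
    right; exists (nn (m, y)).
      by rewrite /= ltnS; apply: leq_trans an; rewrite (aE m)// leq_maxl.
    have [ck _] := nnP (m, y) Wm smy.
    split; first by apply: cseg_ => //; exists y.
    by split=> //; apply: leq_trans an; rewrite (aE m)// leq_maxr.
  rewrite finite_setU; split; first exact: finite_set1.
  apply: bigcup_finite => [|k _]; first exact: finite_II.
  have [[Wc Rc]|h] := pselect (initseg R W m (c m k)).
    by apply: sub_finite_set ((IH _ Rc Wc).1 n) => y [].
  by apply: sub_finite_set (finite_set0 T) => y [].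
have szm : initseg R W m z by [].
have [k0 zE] : exists k, c m k = z.
  by have := szm; rewrite cP//; [case=> k _ <-; exists k|exists z].
have sc k : initseg R W m (c m k) by apply: cseg_ => //; exists z.
(* As [z = c m k0], the least index used for any [y] up to [z] is at most [k0]. Where [a m] differs
   from [a z], either [a (c m k)] already does, or the [maxn] was decided by the index [k]. *)
apply: (@sub_finite_set _ _ (\bigcup_(k in `I_k0.+1)
    ([set y | closed_seg R W z y /\ closed_seg R W (c m k) y /\ a (c m k) y <> a z y] `|`
     [set y | closed_seg R W (c m k) y /\ (a (c m k) y <= k)%N]))).
  move=> y [szy nea].
  have smy : initseg R W m y.
    by have [Wy [Ryz|->//]] := szy; split=> //; exact: tr Ryz Rzm.
  have [/= ck kmin] := nnP (m, y) Wm smy.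
  exists (nn (m, y)); first by rewrite /= ltnS; apply: kmin; rewrite zE.
  have [|ka] := leqP (a (c m (nn (m, y))) y) (nn (m, y)); first by right.
  left; split=> //; split=> // e; apply: nea; rewrite (aE m)// -e.
  by apply/maxn_idPr/ltnW.
apply: bigcup_finite => [|k _]; first exact: finite_II.
have [Wc Rc] := sc k.
rewrite finite_setU; split; last exact: (IH _ Rc Wc).1.
have [Rcz|<-|Rzc] := tri (c m k) z.
- apply: sub_finite_set ((IH _ Rzm Wz).2 _ Wc Rcz) => y [_ [cy ne]].
  by split=> // e; apply: ne.
- by apply: sub_finite_set (finite_set0 T) => y [_ [_]].
- apply: sub_finite_set ((IH _ Rc Wc).2 _ Wz Rzc) => y [zy [_ ne]].
  by split.
Qed.

(* Pairing the coherent value with the rank inside its finite fibre makes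
   a x injective without losing locality: the rank only depends on the
   restriction of a x to the initial segment below the argument. *)
Lemma coherent_injective (T : choiceType) (R : T -> T -> Prop) (W : set T) :
  strict_wo R -> cseg R W -> exists h : T -> T -> nat,
  (forall x, W x -> set_inj (closed_seg R W x) (h x)) /\
  (forall z, W z -> exists c : T -> nat, forall x x', W x -> W x' ->
     R z x -> R z x' -> c x = c x' -> forall y, closed_seg R W z y -> h x y = h x' y).
Proof.
move=> Rwo Wseg; have [tr tri mn] := Rwo.
have [a [afin acoh]] := coherent_finite_to_one Rwo Wseg.
pose fib x y := [set t | initseg R W y t /\ a x t = a x y].
pose h x y := choice.pickle (a x y, #|` fset_set (fib x y)|).
have clt x y t : closed_seg R W x y -> initseg R W y t -> closed_seg R W x t.
  move=> [Wy [Ryx|->]] [Wt Rty]; split=> //; left => //; exact: tr Rty Ryx.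
exists h; split.
  move=> x Wx y y'; rewrite !inE => sy sy' /(pcan_inj choice.pickleK) [e r].
  have key u v : closed_seg R W x u -> closed_seg R W x v -> R u v -> a x u = a x v ->
      (#|` fset_set (fib x u)| < #|` fset_set (fib x v)|)%N.
    move=> su sv Ruv uv.
    have fin t : closed_seg R W x t -> finite_set (fib x t).
      move=> st; apply: sub_finite_set (afin x (a x t) Wx) => s [ts <-].
      by split=> //; exact: clt ts.
    have Wu : W u by case: su.
    apply: fproper_ltn_card; rewrite fproperE; apply/andP; split.
      apply/fsubsetP => s; rewrite !in_fset_set ?inE; [|exact: fin|exact: fin].
      move=> [[Ws Rsu] su']; split; last by rewrite su'.
      by split=> //; exact: tr Rsu Ruv.
    apply/fsubsetPn; exists u; rewrite in_fset_set ?inE//; try exact: fin.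
    by rewrite notin_setE => -[[_ /(strict_wo_irr Rwo)]].
  have [Ryy'|//|Ry'y] := tri y y'.
  - by have := key _ _ sy sy' Ryy' e; rewrite r ltnn.
  - by have := key _ _ sy' sy Ry'y (esym e); rewrite r ltnn.
move=> z Wz.
have /countable_injP[e eI] := countable_closed_seg Wseg Wz.
have /ex_choice[s sP] : forall x, exists s : seq T, W x -> R z x ->
    [set y | closed_seg R W z y /\ a x y <> a z y] = [set` s].
  move=> x; have [[Wx Rzx]|] := pselect (W x /\ R z x); last first.
    by move=> n; exists [::] => Wx Rzx; case: n.
  by have /finite_seqP[s sE] := acoh x z Wx Wz Rzx; exists s.
(* The code lists the finitely many places up to [z] where [a x] departs from [a z], with the values
   there; [e] numbers the places. *)
exists (fun x => choice.pickle [seq (e y, a x y) | y <- s x]) => x x' Wx Wx' Rzx Rzx'.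
move=> /(pcan_inj choice.pickleK) sE.
have sub u v : W u -> W v -> R z u -> R z v ->
    [seq (e y, a u y) | y <- s u] = [seq (e y, a v y) | y <- s v] ->
    forall y, closed_seg R W z y -> a u y <> a z y -> a u y = a v y.
  move=> Wu Wv Rzu Rzv uv y zy ne.
  have yu : y \in s u.
    by have : [set` s u] y by rewrite -sP.
  have : (e y, a u y) \in [seq (e y, a v y) | y <- s v].
    by rewrite -uv; apply/mapP; exists y.
  move=> /mapP[t tv [et ->]].
  have [zt _] : [set y | closed_seg R W z y /\ a v y <> a z y] t by rewrite sP.
  by rewrite (eI y t) ?inE.
have aE y : closed_seg R W z y -> a x y = a x' y.
  move=> zy; have [e1|/(sub x x' Wx Wx' Rzx Rzx' sE y zy)//] := pselect (a x y = a z y).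
  have [e2|] := pselect (a x' y = a z y); first by rewrite e1 e2.
  by move=> /(sub x' x Wx' Wx Rzx' Rzx (esym sE) y zy).
move=> y zy; rewrite /h aE//; congr (choice.pickle (_, #|` fset_set _|)).
have lt t : initseg R W y t -> a x t = a x' t by move=> /(clt _ _ _ zy)/aE.
by apply/seteqP; split=> t [yt atE]; split=> //; move: atE; rewrite lt// aE.
Qed.

(** * Hahn-Banach and linear density *)

Section Sublinear.
Context {R : realType} {V : lmodType R}.

Definition sublinear (q : V -> R) :=
  (forall x y, q (x + y) <= q x + q y) /\
  (forall t x, 0 < t -> q (t *: x) <= t * q x).

Lemma sublinear0 q : sublinear q -> q 0 = 0.
Proof.
move=> [_ qZ]; have h2 := qZ 2 0; have h3 := qZ 2^-1 0.
rewrite !scaler0 in h2 h3.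
have := h2 _; have := h3 _; lra.
Qed.

Lemma sublinearZ q t x : sublinear q -> 0 < t -> q (t *: x) = t * q x.
Proof.
move=> [_ qZ] t0; apply/eqP; rewrite eq_le qZ//=.
have := qZ t^-1 (t *: x); rewrite scalerA mulVf ?gt_eqF// scale1r invr_gt0.
by move=> /(_ t0); rewrite mulrC ler_pdivlMr// mulrC.
Qed.

Lemma sublinear_ge q x : sublinear q -> - q (- x) <= q x.
Proof.
by move=> sq; have := sq.1 x (- x); rewrite subrr sublinear0//; lra.
Qed.

(* q' x is the infimum over t >= 0 of q (x + t y) - t q y. *)
Lemma sublinear_descent q y : sublinear q -> exists q', [/\ sublinear q',
  forall x, q' x <= q x & forall x, q' x <= q (x + y) - q y].
Proof.
move=> sq; have [qD qZ] := sq.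
pose S x : set R := [set z | exists2 t, 0 <= t & z = q (x + t *: y) - t * q y].
have qt t : 0 <= t -> q (t *: y) = t * q y.
  rewrite le_eqVlt => /predU1P[<-|t0]; last exact: sublinearZ.
  by rewrite scale0r mul0r sublinear0.
have lbS x : has_lbound (S x).
  exists (- q (- x)) => _ [t t0 ->].
  have := qD (- x) (x + t *: y); rewrite addrA addNr add0r qt//; lra.
have le t x : 0 <= t -> inf (S x) <= q (x + t *: y) - t * q y.
  by move=> t0; apply: ge_inf => //; exists t.
have ge x z : (forall t, 0 <= t -> z <= q (x + t *: y) - t * q y) -> z <= inf (S x).
  move=> h; apply: lb_le_inf; first by eexists; exists 0.
  by move=> _ [t t0 ->]; exact: h.
exists (fun x => inf (S x)); split.
- split=> [x x'|t x t0].
    rewrite -lerBlDr; apply: (ge) => t t0; rewrite lerBlDr -lerBlDl.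
    apply: (ge) => s s0; have := le (t + s) (x + x') (addr_ge0 t0 s0).
    have -> : x + x' + (t + s) *: y = (x + t *: y) + (x' + s *: y).
      by rewrite scalerDl addrACA.
    have := qD (x + t *: y) (x' + s *: y); lra.
  rewrite mulrC -ler_pdivrMr//; apply: (ge) => s s0; rewrite ler_pdivrMr//.
  have := le (t * s) (t *: x) (mulr_ge0 (ltW t0) s0).
  rewrite -scalerA -scalerDr sublinearZ//; lra.
- by move=> x; have := le 0 x (lexx 0); rewrite scale0r addr0 mul0r subr0.
- by move=> x; have := le 1 x ler01; rewrite scale1r mul1r.
Qed.

(** Zorn's lemma downwards. The pointwise infimum of a chain is finite, being at least [- p (- x)],
    and it is subadditive because any two members of the chain are comparable. *)
Lemma minimal_sublinear p : sublinear p -> exists q, [/\ sublinear q,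
  forall x, q x <= p x &
  forall q', sublinear q' -> (forall x, q' x <= q x) -> forall x, q' x = q x].
Proof.
move=> sp; pose T := {q | sublinear q /\ forall x, q x <= p x}.
(* The order is reversed, so that maximal elements are minimal functions. *)
pose le (q q' : T) := `[< forall x, sval q' x <= sval q x >].
have [||||q qmin] := @Zorn T le.
- by move=> q; apply/asboolP.
- move=> r s t /asboolP rs /asboolP st; apply/asboolP => x.
  exact: le_trans (rs x).
- move=> [s ps] [t pt] /asboolP st /asboolP ts.
  have e : s = t by apply/funext => x; apply/eqP; rewrite eq_le st ts.
  by subst t; congr exist; exact: Prop_irrelevance.
- move=> A Atot; have [->|/set0P[q0 Aq0]] := eqVneq A set0.
    by exists (exist _ p (conj sp (fun=> lexx _))).
  pose S x : set R := [set sval q x | q in A].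
  have lbS x : has_lbound (S x).
    exists (- p (- x)) => _ [[q [sq qp]] _ <-] /=.
    by apply: le_trans (sublinear_ge x sq); rewrite lerN2.
  have leS q x : A q -> inf (S x) <= sval q x.
    by move=> Aq; apply: ge_inf => //; exists q.
  have geS x z : (forall q, A q -> z <= sval q x) -> z <= inf (S x).
    move=> h; apply: lb_le_inf; first by exists (sval q0 x), q0.
    by move=> _ [q Aq <-]; exact: h.
  have sinf : sublinear (fun x => inf (S x)).
    split=> [x y|t x t0].
      rewrite -lerBlDr; apply: (geS) => q Aq; rewrite lerBlDr -lerBlDl.
      apply: (geS) => q' Aq'; rewrite lerBlDr.
      have [/asboolP qq'|/asboolP qq'] := Atot _ _ Aq Aq'.
        have := leS q' (x + y) Aq'; have := (svalP q').1.1 x y; have := qq' x; lra.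
      have := leS q (x + y) Aq; have := (svalP q).1.1 x y; have := qq' y; lra.
    rewrite mulrC -ler_pdivrMr//; apply: (geS) => q Aq; rewrite ler_pdivrMr//.
    apply: le_trans (leS q _ Aq) _; rewrite mulrC; exact: (svalP q).1.2.
  have infp x : inf (S x) <= p x by apply: le_trans (leS q0 x Aq0) _; exact: (svalP q0).2.
  exists (exist _ (fun x => inf (S x)) (conj sinf infp) : T) => q Aq; apply/asboolP => x /=.
  exact: leS.
case: q qmin => q [sq qp] qmin; exists q; split=> // q' sq' q'q x.
have q'p : forall x, q' x <= p x by move=> z; apply: le_trans (q'q z) _.
have /(congr1 sval)/= -> // : (exist _ q' (conj sq' q'p) : T) = exist _ q (conj sq qp).
by apply: qmin; apply/asboolP.
Qed.

(** A minimal sublinear function is additive, as descending along [z] cannot lower it. A first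
    descent along [y] bounds the value at [- y] by [- p y], whence the lower bound on [f y]. *)
Lemma hahn_banach_sublinear p y : sublinear p ->
  exists f : {linear V -> R^o}, (forall x, f x <= p x) /\ p y <= f y.
Proof.
move=> sp; have [p' [sp' p'p p'y]] := sublinear_descent y sp.
have [q [sq qp' qmin]] := minimal_sublinear sp'.
have qD x z : q (x + z) = q x + q z.
  apply/eqP; rewrite eq_le sq.1/=.
  have [q' [sq' q'q q'z]] := sublinear_descent z sq.
  by have := q'z x; rewrite (qmin q')//; lra.
have qN x : q (- x) = - q x.
  by have := qD x (- x); rewrite subrr sublinear0//; lra.
have lq : linear (q : V -> R^o).
  move=> t x z; rewrite qD; congr (_ + _).
  have [t0|t0|->] := ltgtP t 0; last by rewrite scale0r sublinear0// scale0r.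
    rewrite -[t *: x]opprK -scaleNr qN sublinearZ ?oppr_gt0//.
    by rewrite mulNr opprK.
  by rewrite sublinearZ.
pose f : {linear V -> R^o} := HB.pack (q : V -> R^o) (GRing.isLinear.Build _ _ _ _ _ lq).
exists f; split=> [x|] /=; first exact: le_trans (qp' x) (p'p x).
have := qp' (- y); have := p'y (- y); rewrite addNr sublinear0// qN; lra.
Qed.

End Sublinear.

Section Span.
Context {R : realType} {X : completeNormedModType R}.
Implicit Types (A : set X) (f : {linear X -> R^o}).

Lemma linspanP A x : linspan A x <->
  exists2 s : seq (R * X), (forall p, p \in s -> A p.2) & x = \sum_(p <- s) p.1 *: p.2.
Proof.
split=> [[n [a [v [Av ->]]]]|[s sA ->]].
  exists [seq (a i, v i) | i <- index_enum 'I_n].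
    by move=> _ /mapP[i _ ->]; exact: Av.
  by rewrite big_map.
exists (size s), (fun i => (tnth (in_tuple s) i).1), (fun i => (tnth (in_tuple s) i).2).
by rewrite big_tnth; split=> // i; apply: sA; exact: mem_tnth.
Qed.

Lemma linspan0 A : linspan A 0.
Proof. by apply/linspanP; exists [::]; rewrite ?big_nil. Qed.

Lemma linspanD A x y : linspan A x -> linspan A y -> linspan A (x + y).
Proof.
move=> /linspanP[s sA ->] /linspanP[t tA ->]; apply/linspanP; exists (s ++ t).
  by move=> p; rewrite mem_cat => /orP[/sA|/tA].
by rewrite big_cat.
Qed.

Lemma linspanZ A t x : linspan A x -> linspan A (t *: x).
Proof.
move=> /linspanP[s sA ->]; apply/linspanP; exists [seq (t * p.1, p.2) | p <- s].
  by move=> _ /mapP[p /sA ? ->].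
by rewrite big_map scaler_sumr; apply: eq_bigr => p _; rewrite scalerA.
Qed.

Lemma linspan_sub A x : A x -> linspan A x.
Proof.
move=> Ax; apply/linspanP; exists [:: (1, x)]; last by rewrite big_seq1 scale1r.
by move=> p; rewrite inE => /eqP ->.
Qed.

Lemma linear_linspan_eq0 A f x :
  (forall a, A a -> f a = 0) -> linspan A x -> f x = 0.
Proof.
move=> fA /linspanP[s sA ->]; rewrite linear_sum big_seq big1// => p /sA/fA.
by rewrite linearZ/= => ->; rewrite scaler0.
Qed.

Lemma dense_normP A : dense A <->
  forall x e, 0 < e -> exists2 y, A y & `|x - y| < e.
Proof.
split=> [dA x e e0|dA O [x Ox] oO].
  have [|y [xy Ay]] := dA (ball x e) _ (ball_open x e).
    by exists x; exact: ballxx.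
  by exists y => //; move: xy; rewrite -ball_normE.
have /nbhs_ballP[e /= e0 eO] : nbhs x O by exact: open_nbhs_nbhs.
have [y Ay xy] := dA x e e0.
by exists y; split=> //; apply: eO; rewrite -ball_normE.
Qed.

Lemma continuous_linear_le f : continuous f ->
  exists2 M, 0 < M & forall x, `|f x| <= M * `|x|.
Proof.
move=> /linear_bounded_continuous/linear_boundedP/pinfty_ex_gt0[M M0 h].
by exists M.
Qed.

Lemma linear_le_continuous f M : (forall x, `|f x| <= M * `|x|) -> continuous f.
Proof.
move=> h; apply/linear_bounded_continuous/linear_boundedP.
apply: filterS (nbhs_pinfty_ge (num_real M)) => r Mr x.
by apply: le_trans (h x) _; rewrite ler_wpM2r.
Qed.

(** The dominating sublinear function is the distance to the span of [A]: it vanishes on [A], is at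
    least [e] at [x] and is bounded by the norm. *)
Lemma hahn_banach_dist A x e : 0 < e -> (forall m, linspan A m -> e <= `|x - m|) ->
  exists f, [/\ continuous f, forall a, A a -> f a = 0 & f x != 0].
Proof.
move=> e0 h; pose S v : set R := [set `|v - m| | m in linspan A].
have lbS v : has_lbound (S v) by exists 0 => _ [m _ <-].
have le v m : linspan A m -> inf (S v) <= `|v - m|.
  by move=> Am; apply: ge_inf => //; exists m.
have ge v z : (forall m, linspan A m -> z <= `|v - m|) -> z <= inf (S v).
  move=> zP; apply: lb_le_inf; first by exists `|v - 0|, 0 => //; exact: linspan0.
  by move=> _ [m Am <-]; exact: zP.
have [|f [fp fx]] := @hahn_banach_sublinear R X (fun v => inf (S v)) x.
  split=> [u v|t v t0].
    rewrite -lerBlDr; apply: (ge) => m Am; rewrite lerBlDr -lerBlDl.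
    apply: (ge) => n An; rewrite lerBlDl.
    apply: le_trans (le _ _ (linspanD Am An)) _.
    by rewrite opprD addrACA; exact: ler_normD.
  rewrite mulrC -ler_pdivrMr//; apply: (ge) => m Am; rewrite ler_pdivrMr//.
  apply: le_trans (le _ _ (linspanZ t Am)) _.
  by rewrite -scalerBr normrZ gtr0_norm// mulrC.
have fle v : f v <= `|v|.
  by apply: le_trans (fp v) _; rewrite -[v in leRHS]subr0; apply: le; exact: linspan0.
exists f; split.
- apply: (@linear_le_continuous _ 1) => v; rewrite mul1r ler_norml fle andbT.
  by have := fle (- v); rewrite normrN linearN/=; lra.
- move=> a Aa; have Am := linspan_sub Aa.
  have h1 := le_trans (fp a) (le a a Am).
  have h2 := le_trans (fp (- a)) (le (- a) (- a) _).
  have := h2 _; rewrite -scaleN1r; move=> /(_ (linspanZ _ Am)).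
  by move: h1; rewrite scaleN1r !subrr normr0 linearN/=; lra.
- by rewrite gt_eqF//; apply: lt_le_trans fx; apply: lt_le_trans e0 _; exact: ge.
Qed.

(** The dual form of linear density, in which overcompleteness is tested below. *)
Definition total_set A := forall f, continuous f -> (forall a, A a -> f a = 0) ->
  forall x, f x = 0.

Lemma total_linearly_dense A : total_set A -> linearly_dense A.
Proof.
move=> tA; apply/dense_normP => x e e0; apply: contrapT => h.
have [m Am|f [cf fA]] := @hahn_banach_dist A x e e0.
  by rewrite leNgt; apply/negP => xm; apply: h; exists m.
by rewrite tA ?eqxx.
Qed.

Lemma dense_total A f : continuous f -> dense A ->
  (forall a, A a -> f a = 0) -> forall x, f x = 0.
Proof.
move=> /continuous_linear_le[M M0 fM] /dense_normP dA fA x; apply/eqP.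
rewrite -normr_le0 leNgt; apply/negP => fx0.
have [|y Ay xy] := dA x (`|f x| / M); first exact: divr_gt0.
have := fM (x - y); rewrite linearB/= (fA y Ay) subr0.
by move: xy; rewrite ltr_pdivlMr// mulrC; lra.
Qed.

Lemma linearly_dense_total A : linearly_dense A -> total_set A.
Proof.
by move=> dA f cf fA; apply: dense_total dA _ => // x; exact: linear_linspan_eq0.
Qed.

Lemma functionals_separate x : (forall f, continuous f -> f x = 0) -> x = 0.
Proof.
move=> fx; apply/eqP/negP => /negP; rewrite -normr_gt0 => x0.
have [m /linspanP[s sA ->]|f [cf _]] := @hahn_banach_dist set0 x _ x0.
  by rewrite big_seq big1 ?subr0// => p /sA.
by rewrite fx ?eqxx.
Qed.

(** The finite rational combinations of elements of [A] are dense, and there are at most as many of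
    them as elements of [B]. *)
Lemma dense_card_le T (B : set T) A : infinite_set B -> A #<= B ->
  linearly_dense A -> exists2 D : set X, dense D & D #<= B.
Proof.
move=> Bi AB /dense_normP dA.
pose L := [set s : seq (rat * X) | forall p, p \in s -> ([set: rat] `*` A) p].
pose v (s : seq (rat * X)) : X := \sum_(p <- s) ratr p.1 *: p.2.
exists (v @` L); last first.
  apply: card_le_trans (card_image_le _ _) _; apply: card_seq_le => //.
  apply: card_le_trans (card_le_sqr Bi); apply: card_leX => //.
  by apply: card_le_trans (_ : _ #<= [set: nat]) _; [exact: countableP|exact/infiniteP].
apply/dense_normP => x e e0.
have e20 : 0 < e / 2 by lra.
have [_ /linspanP[s sA ->] xs] := dA x (e / 2) e20.
suff [t Lt st] : exists2 t, L t & `|\sum_(p <- s) p.1 *: p.2 - v t| < e / 2.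
  exists (v t); first by exists t.
  have := ler_distD (\sum_(p <- s) p.1 *: p.2) x (v t); lra.
elim: s sA {x xs dA e0} (e / 2) e20 => [|[a y] s IH] sA d d0.
  by exists [::] => //; rewrite /v !big_nil subrr normr0.
have d20 : 0 < d / 2 by lra.
have [p ps|t Lt st] := IH _ _ d20; first by apply: sA; rewrite inE ps orbT.
(* Half of the error goes to the coefficient of [y]; the [1 +] avoids dividing by zero. *)
have y0 : 0 < 1 + `|y| by rewrite ltr_wpDr.
have := divr_gt0 d20 y0; set d' := _ / _ => d'0.
have [|q] := @rat_in_itvoo R a (a + d'); first by rewrite ltrDl.
rewrite in_itv/= => /andP[qa1 qa2].
exists ((q, y) :: t).
  move=> p; rewrite inE => /predU1P[->|/Lt//]; split=> //=.
  by apply: (sA (a, y)); rewrite mem_head.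
rewrite /v !big_cons/= -/(v t) opprD addrACA -scalerBl.
apply: le_lt_trans (ler_normD _ _) _; rewrite normrZ.
have h : `|a - ratr q| * `|y| <= d / 2.
  apply: le_trans (_ : d' * (1 + `|y|) <= _); last by rewrite divfK ?gt_eqF.
  apply: ler_pM => //; last by rewrite lerDr.
  by rewrite ler_norml; apply/andP; split; lra.
lra.
Qed.

(** [C] gathers the vectors used in a sequence of combinations converging to [x]. *)
Lemma countable_support A x : linearly_dense A -> exists C, [/\ C `<=` A,
  countable C & forall f, continuous f -> (forall a, C a -> f a = 0) -> f x = 0].
Proof.
move=> /dense_normP dA.
have /ex_choice[s sP] : forall n : nat, exists s : seq (R * X),
    (forall p, p \in s -> A p.2) /\ `|x - \sum_(p <- s) p.1 *: p.2| < n.+1%:R^-1.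
  move=> n; have [|_ /linspanP[s sA ->] xs] := dA x n.+1%:R^-1; first by rewrite invr_gt0.
  by exists s.
exists (\bigcup_n [set p.2 | p in [set` s n]]); split.
- by move=> _ [n _ [p ps <-]]; exact: (sP n).1.
- apply: bigcup_countable => [|n _]; first exact: countableP.
  by apply/finite_set_countable/finite_image; exact: finite_seq.
move=> f /continuous_linear_le[M M0 fM] fC; apply/eqP.
rewrite -normr_le0; apply/ler_addgt0Pr => e e0; rewrite add0r.
have [n nM] : exists n : nat, M / e < n.+1%:R.
  exists (Num.bound (M / e)); apply: lt_le_trans (archi_boundP _) _.
    by rewrite divr_ge0// ltW.
  by rewrite ler_nat.
have [sA xs] := sP n.
have f0 : f (\sum_(p <- s n) p.1 *: p.2) = 0.
  apply: linear_linspan_eq0 fC _; apply/linspanP; exists (s n) => // p ps.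
  by exists n => //; exists p.
have := fM (x - \sum_(p <- s n) p.1 *: p.2).
rewrite linearB/= f0 subr0 => /le_trans; apply.
apply: le_trans (_ : M * n.+1%:R^-1 <= _); first by rewrite ler_pM2l// ltW.
by rewrite ler_pdivrMr// mulrC -ler_pdivrMr// ltW.
Qed.

End Span.

(** * Zeros of power series *)

Section PowerSeries.
Context {R : realType}.
Implicit Types (c : nat -> R) (m M : R).

Lemma power_series_cvg (V : completeNormedModType R) (v : nat -> V) M m :
  (forall n, `|v n| <= M) -> `|m| < 1 -> cvgn (series (fun n => m ^+ n *: v n)).
Proof.
move=> vM m1; apply: normed_cvg.
apply: (@series_le_cvg _ _ (geometric M `|m|)) => [n|n|n|].
- exact: normr_ge0.
- by rewrite /= mulr_ge0 ?exprn_ge0// (le_trans _ (vM n)).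
- by rewrite /= normrZ normrX mulrC ler_wpM2r ?exprn_ge0.
- by apply: is_cvg_geometric_series; rewrite normr_id.
Qed.

Lemma power_series_cvgR c M m :
  (forall n, `|c n| <= M) -> `|m| < 1 -> cvgn (series (fun n => m ^+ n * c n)).
Proof. exact: (@power_series_cvg R^o). Qed.

(** The factor [4 / 3] is the sum of the geometric series of ratio [4^-1]. *)
Lemma power_series_norm_le c M m : (forall n, `|c n| <= M) -> `|m| <= 4^-1 ->
  `|limn (series (fun n => m ^+ n * c n))| <= 4 / 3 * M.
Proof.
move=> cM m4; have m1 : `|m| < 1 by lra.
have M0 : 0 <= M by apply: le_trans (cM 0%N).
have cv := power_series_cvgR cM m1.
rewrite -lim_norm//; apply: limr_le; first exact: is_cvg_norm.
near=> N; rewrite /series /=.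
apply: le_trans (_ : 4 / 3 * M * (1 - 4^-1 ^+ N) <= _); last first.
  by apply: ler_piMr; [rewrite mulr_ge0|rewrite gerBl exprn_ge0].
elim: (N) => [|n IH]; first by rewrite big_geq// normr0 expr0 subrr mulr0.
rewrite big_nat_recr//=; apply: le_trans (ler_normD _ _) _.
have h : `|m ^+ n * c n| <= 4^-1 ^+ n * M.
  by rewrite normrM normrX ler_pM// ?exprn_ge0// lerXn2r ?nnegrE.
by move: IH h; rewrite exprS; set t := 4^-1 ^+ n; lra.
Unshelve. all: by end_near. Qed.

Lemma seriesS_power c m N : series (fun n => m ^+ n * c n) N.+1 =
  c 0%N + m * series (fun n => m ^+ n * c n.+1) N.
Proof.
rewrite /series /= big_nat_recl//= expr0 mul1r mulr_sumr; congr (_ + _).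
by apply: eq_bigr => i _; rewrite exprS mulrA.
Qed.

Lemma power_series_lim_rec c M m : (forall n, `|c n| <= M) -> `|m| < 1 ->
  limn (series (fun n => m ^+ n * c n)) =
  c 0%N + m * limn (series (fun n => m ^+ n * c n.+1)).
Proof.
move=> cM m1; apply/cvg_lim => //.
have cv : series (fun n => m ^+ n * c n.+1) @ \oo -->
    limn (series (fun n => m ^+ n * c n.+1)).
  exact: (@power_series_cvgR (fun n => c n.+1) M).
rewrite -(cvg_shiftS (series _)) /=.
under eq_fun do rewrite seriesS_power.
by apply: cvgD; [exact: cvg_cst|apply: cvgM => //; exact: cvg_cst].
Qed.

(* Each zero of the power series in ]0, 1/4] can be divided out; this multiplies
   the bound on the coefficients by at most 4/3 and the constant coefficient by
   the inverse of the zero, hence by at least 4. *)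
Lemma power_series_coef0_le (s : seq R) c M : uniq s ->
  (forall m, m \in s -> 0 < m <= 4^-1 /\
     series (fun n => m ^+ n * c n) @ \oo --> (0 : R)) ->
  (forall n, `|c n| <= M) -> `|c 0%N| <= M * 3^-1 ^+ size s.
Proof.
elim: s c M => [|m s IH] c M /=; first by move=> _ _ /(_ 0%N); rewrite expr0 mulr1.
move=> /andP[ms us] zs cM.
have [/andP[m0 m4] cm] := zs m (mem_head _ _).
have m4' : `|m| <= 4^-1 by rewrite gtr0_norm.
have m1 : `|m| < 1 by lra.
(* As [Q 0 = 0], the numbers [Q n.+1] are the coefficients of the quotient of the series by
   [x - m]. *)
pose Q k := limn (series (fun n => m ^+ n * c (k + n)%N)).
have QE k : Q k = c k + m * Q k.+1.
  have e : (fun n => m ^+ n * c (k.+1 + n)%N) = (fun n => m ^+ n * c (k + n.+1)%N).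
    by apply/funext => n; rewrite addSnnS.
  by rewrite /Q e (@power_series_lim_rec (fun n => c (k + n)%N) M)// addn0.
have Q0 : Q 0%N = 0 by exact/cvg_lim.
have QM k : `|Q k| <= 4 / 3 * M by apply: power_series_norm_le.
have Q1 : `|Q 1%N| <= 4 / 3 * M * 3^-1 ^+ size s.
  apply: (IH (fun n => Q n.+1)) => // x xs.
  have [/andP[x0 x4] cx] := zs x (mem_behead (s := m :: s) xs); split; first exact/andP.
  have xm : x - m != 0 by rewrite subr_eq0; apply: contraNneq ms => <-.
  have part N : series (fun n => x ^+ n * Q n.+1) N =
      (x - m)^-1 * (x ^+ N * Q N + series (fun n => x ^+ n * c n) N).
    apply: (mulfI xm); rewrite mulrA divff// mul1r.
    elim: N => [|N IHN]; first by rewrite /series /= !big_geq// Q0 !mulr0 addr0.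
    move: IHN; rewrite /series /= !big_nat_recr//= mulrDr => ->.
    rewrite (QE N) exprS; set a := x ^+ N; set b := \sum_(_ <= _ < _) _.
    by rewrite !mulrDl !mulrDr !mulNr -!addrA; lra.
  rewrite (_ : series _ = fun N =>
      (x - m)^-1 * (x ^+ N * Q N + series (fun n => x ^+ n * c n) N)).
    rewrite -[X in _ --> X](mulr0 (x - m)^-1); apply: cvgM; first exact: cvg_cst.
    rewrite -[X in _ --> X]addr0; apply: cvgD => //.
    have x1 : `|x| < 1 by rewrite gtr0_norm//; lra.
    apply: norm_cvg0; apply: (@squeeze_cvgr _ _ _ _ (cst 0) (geometric (4 / 3 * M) `|x|)).
    - near=> N; rewrite /cst normr_ge0/= normrM normrX mulrC.
      by rewrite ler_wpM2r// exprn_ge0.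
    - exact: cvg_cst.
    - by apply: cvg_geometric; rewrite normr_id.
  by apply/funext => N; exact: part.
have := QE 0%N; rewrite Q0 => /esym/eqP; rewrite addr_eq0 => /eqP ->.
rewrite normrN normrM exprS.
apply: le_trans (ler_pM _ _ m4' Q1) _ => //.
by set t := _ ^+ size s; lra.
Unshelve. all: by end_near. Qed.

(** Arbitrarily many zeros force the constant coefficient to vanish, by [power_series_coef0_le].
    Dividing by [m] then shifts the coefficients and keeps the zeros, so induction reaches all of
    them. *)
Lemma power_series_eq0 c M (Z : set R) : infinite_set Z ->
  (forall m, Z m -> 0 < m <= 4^-1 /\
     series (fun n => m ^+ n * c n) @ \oo --> (0 : R)) ->
  (forall n, `|c n| <= M) -> forall n, c n = 0.
Proof.
move=> Zi; have c0 d : (forall m, Z m -> 0 < m <= 4^-1 /\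
     series (fun n => m ^+ n * d n) @ \oo --> (0 : R)) ->
    (forall n, `|d n| <= M) -> d 0%N = 0.
  move=> dZ dM; have M0 : 0 <= M by apply: le_trans (dM 0%N).
  have h N : `|d 0%N| <= M * 3^-1 ^+ N.
    have [s sZ sN] := infinite_set_fset N Zi.
    have /le_trans : `|d 0%N| <= M * 3^-1 ^+ size s.
      apply: power_series_coef0_le => //; first exact: fset_uniq.
      by move=> m /sZ; exact: dZ.
    apply; rewrite ler_wpM2l// ler_wiXn2l// ?invr_ge0//.
    by rewrite invf_le1//; lra.
  apply/eqP; rewrite -normr_le0.
  have /cvg_lim <- // : geometric M (3^-1 : R) @ \oo --> (0 : R).
    by apply: cvg_geometric; rewrite gtr0_norm ?invr_gt0// invf_lt1//; lra.
  apply: limr_ge; last by near=> N; exact: h.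
  apply/cvg_ex; exists 0; apply: cvg_geometric.
  by rewrite gtr0_norm ?invr_gt0// invf_lt1//; lra.
move=> cZ cM n; rewrite -(addn0 n); apply: (c0 (fun k => c (n + k)%N)) => //.
elim: n => [|n IH]; first exact: cZ.
move=> m Zm; have [mI cv] := IH m Zm; split=> //.
have cn : c n = 0 by rewrite -(addn0 n); exact: (c0 (fun k => c (n + k)%N)).
have [m0 _] := andP mI.
rewrite (_ : series _ = fun N => m^-1 * series (fun k => m ^+ k * c (n + k)%N) N.+1).
  rewrite -[X in _ --> X](mulr0 m^-1); apply: cvgM; first exact: cvg_cst.
  by rewrite (cvg_shiftS (series (fun k => m ^+ k * c (n + k)%N))).
apply/funext => N; rewrite seriesS_power addn0 cn add0r mulrA mulVf ?gt_eqF// mul1r.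
by congr (series _ N); apply/funext => k; rewrite addSnnS.
Unshelve. all: by end_near. Qed.

Context {X : completeNormedModType R}.

Definition power_sum (v : nat -> X) m : X := limn (series (fun n => m ^+ n *: v n)).

Lemma power_sum_functional (f : {linear X -> R^o}) v m : continuous f ->
  (forall n, `|v n| <= 1) -> 0 < m <= 4^-1 ->
  series (fun n => m ^+ n * f (v n)) @ \oo --> (f (power_sum v m) : R).
Proof.
move=> cf v1 /andP[m0 m4].
have m1 : `|m| < 1 by rewrite gtr0_norm//; lra.
have cv : series (fun n => m ^+ n *: v n) @ \oo --> power_sum v m.
  exact: power_series_cvg m1.
have -> : series (fun n => m ^+ n * f (v n)) =
    (fun N => f (series (fun n => m ^+ n *: v n) N)).
  apply/funext => N; rewrite /series /= linear_sum; apply: eq_bigr => i _.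
  by rewrite linearZ.
exact: (continuous_cvg _ (cf (power_sum v m)) cv).
Qed.

End PowerSeries.

(** * Overcomplete sets *)

Lemma itv_uncountable (R : realType) (a b : R) : a < b -> ~ countable `]a, b]%classic.
Proof.
move=> ab /countable_lebesgue_measure0/eqP; rewrite lebesgue_measure_itv/= lte_fin ab.
by rewrite -EFinD eqe subr_eq0 gt_eqF.
Qed.

Section Overcomplete.
Context {R : realType} {X : completeNormedModType R}.
Implicit Types (f : {linear X -> R^o}) (A K Y : set X).

Lemma card_is_dens_countable K A : card_is_dens K -> countable A ->
  linearly_dense A -> countable K.
Proof.
move=> [_ Kle] Ac Ad; have [D Dd Dc] := dense_card_le infinite_nat Ac Ad.
exact: card_le_trans (Kle _ Dd) Dc.
Qed.

Lemma card_is_dens_eq K Y : card_is_dens K -> Y #= K -> card_is_dens Y.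
Proof.
move=> [[D Dd KD] Kle] YK; split.
  by exists D => //; exact: card_eq_trans YK KD.
by move=> E Ed; have /card_eqPle[YK' _] := YK; exact: card_le_trans YK' (Kle _ Ed).
Qed.

(** The [1 +] spares a separate case for the zero vector. *)
Definition normalize (x : X) : X := (1 + `|x|)^-1 *: x.

Lemma normalize_le1 x : `|normalize x| <= 1.
Proof.
have x0 : 0 < 1 + `|x| by rewrite ltr_wpDr.
by rewrite normrZ gtr0_norm ?invr_gt0// mulrC ler_pdivrMr// mul1r lerDr.
Qed.

Lemma linear_normalize_eq0 f x : f (normalize x) = 0 -> f x = 0.
Proof.
have x0 : 0 < 1 + `|x| by rewrite ltr_wpDr.
rewrite linearZ/= => /eqP; rewrite mulf_eq0 invr_eq0 gt_eqF//= => /eqP.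
exact.
Qed.

Lemma functional_bounded f (v : nat -> X) : continuous f ->
  (forall n, `|v n| <= 1) -> exists M, forall n, `|f (v n)| <= M.
Proof.
move=> /continuous_linear_le[M M0 fM] v1; exists M => n.
by apply: le_trans (fM _) _; rewrite ler_piMr// ltW.
Qed.

(** Otherwise a functional vanishing at [x] vanishes everywhere, and [x] spans [X]. The lemma serves
    to show that Klee's vectors take no value infinitely often. *)
Lemma infinite_dimensional_functional x : infinite_dimensional X ->
  exists f, [/\ continuous f, f x = 0 & exists z, f z != 0].
Proof.
move=> dimX; apply: contrapT => h; apply: dimX.
have {}h f : continuous f -> f x = 0 -> forall z, f z = 0.
  move=> cf fx z; apply/eqP; apply: contra_notT h => fz.
  by exists f; split=> //; exists z.
exists [set x]; first exact: finite_set1.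
apply/seteqP; split=> // z _.
have [[f [cf fx]]|h0] := pselect (exists f, continuous f /\ f x != 0).
  suff -> : z = (f z / f x) *: x by apply: linspanZ; exact: linspan_sub.
  apply/eqP; rewrite -subr_eq0; apply/eqP; apply: functionals_separate => g cg.
  (* This combination of [f] and [g] vanishes at [x], hence at [z]. *)
  pose k : {linear X -> R^o} := (f x \*: g) \- (g x \*: f).
  have ck : continuous k.
    by move=> t; exact: cvgB (cvgZ (cvg_cst _) (cg t)) (cvgZ (cvg_cst _) (cf t)).
  have kz : f x * g z = g x * f z.
    apply/eqP; rewrite -subr_eq0; apply/eqP; apply: (h k ck).
    by rewrite /= [g x *: _]mulrC subrr.
  rewrite linearB linearZ /=; apply/eqP; rewrite subr_eq0; apply/eqP.
  apply: (mulfI fx); rewrite kz -[_ *: _]/(f z / f x * g x).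
  by rewrite mulrA mulrCA divff// mulr1 mulrC.
suff -> : z = 0 by exact: linspan0.
apply: functionals_separate => f cf; apply: h => //.
by apply/eqP; apply: contra_notT h0 => fx; exists f.
Qed.

Lemma separable_overcomplete K : infinite_dimensional X -> card_is_dens K ->
  countable K -> exists Y, overcomplete Y.
Proof.
move=> dimX dK Kc; have [[D Dd KD] _] := dK.
have /card_eqPle[KleD DleK] := KD.
have Dc : countable D := card_le_trans DleK Kc.
have Di : infinite_set D.
  (* A finite set is closed, so if dense it would be all of [X]. *)
  move=> Df; apply: dimX; exists D => //; apply/seteqP; split=> // x _.
  apply: linspan_sub; apply: contrapT => nDx.
  have [||y [nDy Dy]] := Dd (~` D); [by exists x| |by []].
  rewrite openC; apply: (accessible_finite_set_closed.1 _) => //.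
  exact/hausdorff_accessible/norm_hausdorff.
have /pfcard_geP[D0|/surjfunPex[e eE]] := Dc.
  by case: Di; rewrite D0; exact: finite_set0.
pose v n := normalize (e n); have v1 n : `|v n| <= 1 by exact: normalize_le1.
pose lam k : R := 4^-1 ^+ k.+1.
have lamI : injective lam.
  have q1 : (4^-1 : R) != 1 by rewrite lt_eqF//; lra.
  by move=> i j /(ieexprIn _ q1); rewrite invr_gt0 => /(_ (ltr0Sn _ _))[].
have lamP k : 0 < lam k <= 4^-1.
  rewrite exprn_gt0 ?invr_gt0//= /lam exprS ler_piMr// ?exprn_ile1//; lra.
pose y k := power_sum v (lam k).
have key (I : set nat) f : infinite_set I -> continuous f ->
    (forall k, I k -> f (y k) = 0) -> forall x, f x = 0.
  move=> Ii cf fI; have [M fM] := functional_bounded cf v1.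
  have fv := @power_series_eq0 R (fun n => f (v n)) M (lam @` I) _ _ fM.
  apply: (dense_total cf Dd); rewrite eE => _ [n _ <-].
  apply: linear_normalize_eq0; apply: fv.
    move=> lf; apply: Ii; apply: card_le_finite lf.
    by apply: (@ex_card_le _ _ _ _ lam) => [k Ik|i j _ _ /lamI//]; exists k.
  move=> _ [k Ik <-]; split=> //; rewrite -(fI k Ik).
  exact: power_sum_functional cf v1 (lamP k).
(* If the range were finite, some value [t] would be taken infinitely often, and [key] would
   annihilate every functional vanishing at [t]. *)
have Yi : infinite_set (range y).
  move=> Yf; have [t ti] : exists t, infinite_set (y @^-1` [set t]).
    apply: contrapT => h; apply: infinite_nat.
    apply: (@sub_finite_set _ _ (\bigcup_(t in range y) (y @^-1` [set t]))).
      by move=> k _; exists (y k) => //; exists k.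
    by apply: bigcup_finite => // t _; apply: contrapT => nt; apply: h; exists t.
  have [f [cf ft [z]]] := infinite_dimensional_functional t dimX.
  by rewrite (key _ f ti cf) ?eqxx// => k /= ->.
have /infiniteP nY := Yi; have /infiniteP nD := Di.
exists (range y); split.
  apply: card_is_dens_eq dK _; apply/card_eqPle; split.
    apply: card_le_trans (card_image_le _ _) _; exact: card_le_trans nD DleK.
  exact: card_le_trans Kc nY.
move=> Z ZY ZeY; apply: total_linearly_dense => f cf fZ.
apply: (key (y @^-1` Z)) => // [Zf|k /fZ//]; apply: Yi.
rewrite -(eq_finite_set ZeY); apply: sub_finite_set (finite_image y Zf).
by move=> z Zz; have [k _ kz] := ZY _ Zz; exists k => //=; rewrite kz.
Qed.

Lemma nonseparable_overcomplete K : WLD X -> card_is_dens K -> K #<= omega1 ->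
  ~ countable K -> exists Y, overcomplete Y.
Proof.
move=> [D0 D0d D0supp] dK Kw Ku; have [[E Ed KE] Kle] := dK.
have /ex_choice[C CP] : forall k, exists C, [/\ C `<=` D0, countable C &
    forall f, continuous f -> (forall a, C a -> f a = 0) -> f k = 0].
  by move=> k; exact: countable_support.
(* This cuts [D0] down to at most [omega1] vectors while keeping it total; supports remain
   countable. *)
pose D := \bigcup_(k in E) C k.
have DD0 : D `<=` D0 by move=> d [k _]; have [+ _ _] := CP k; exact.
have Dt : total_set D.
  move=> f cf fD; apply: (dense_total cf Ed) => k Ek.
  by have [_ _] := CP k; apply=> // a Ca; apply: fD; exists k.
have Dw : D #<= omega1.
  apply: card_bigcup_le; first exact: infinite_omega1.
    by have /card_eqPle[_ EK] := KE; exact: card_le_trans EK Kw.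
  by move=> k _; have [_ ? _] := CP k; exact: countable_le_omega1.
have Du : ~ countable D.
  by move=> /(card_is_dens_countable dK)/(_ (total_linearly_dense Dt)).
have [r rwo] := ex_strict_wo X; have [tr tri mn] := rwo.
have [W [WD Wu Wseg]] := ex_cseg rwo Du.
have clW x : W x -> countable (closed_seg r W x) by exact: countable_closed_seg.
(* [W] is only an index set of type [omega1] found inside [D]; [b] enumerates all of [D] along
   it. *)
have /card_set_bijP[b [bF bI bS]] : W #= D.
  apply/card_eqPle; split; first exact: subset_card_le.
  exact: card_le_trans Dw (omega1_le_cseg rwo Wu Wseg).
have q0 : (0 : R) < 4^-1 by rewrite invr_gt0.
have lW := cseg_card_le rwo Wseg (itv_uncountable q0).
have [|lam lamF lamI] := card_le_ex _ lW.
  by exists 4^-1; rewrite /= in_itv/= q0 lexx.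
have lamP x : W x -> 0 < lam x <= 4^-1 by move=> /lamF; rewrite /= in_itv.
have [h [hI hloc]] := coherent_injective rwo Wseg.
pose v x n := xget 0
  [set z | exists2 y, closed_seg r W x y & h x y = n /\ z = normalize (b y)].
have vE x y : W x -> closed_seg r W x y -> v x (h x y) = normalize (b y).
  move=> Wx sy; rewrite /v; case: xgetP => [z _ [t st [ht ->]]|].
    by congr (normalize (b _)); apply: (hI x Wx) => //; rewrite inE.
  by move=> /(_ (normalize (b y))) []; exists y.
have vP x n : v x n = 0 \/
    exists2 y, closed_seg r W x y & h x y = n /\ v x n = normalize (b y).
  by rewrite /v; case: xgetP => [z _ H|_]; [right|left].
have v1 x n : `|v x n| <= 1.
  have [->|[y _ [_ ->]]] := vP x n; last exact: normalize_le1.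
  by rewrite normr0.
pose y x := power_sum (v x) (lam x).
have key (A : set X) f : A `<=` W -> ~ countable A -> continuous f ->
    (forall x, A x -> f (y x) = 0) -> forall x, f x = 0.
  move=> AW Au cf fA.
  pose supp := [set x | W x /\ f (b x) != 0].
  have suppc : countable supp.
    apply: sub_countable (D0supp f cf); apply: (@ex_card_le _ _ _ _ b).
      by move=> x [Wx fbx]; split=> //; apply: DD0; exact: bF.
    by move=> s t [Ws _] [Wt _] /bI; rewrite !inE; exact.
  (* A countable set of indices is bounded in [W], because closed segments are countable and [W] is
     not. *)
  have [g Wg gP] : exists2 g, W g & forall x, supp x -> r x g.
    apply: contrapT => nog; apply: Wu.
    apply: (@sub_countable _ _ _ (\bigcup_(x in supp) closed_seg r W x)).
      apply: subset_card_le => g Wg; apply: contrapT => ng; apply: nog; exists g => // x sx.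
      have [//|xg|rgx] := tri x g; case: ng; exists x => //; split=> //.
        by right.
      by left.
    by apply: bigcup_countable => // x [Wx _]; exact: clW.
  have [c cP] := hloc g Wg.
  pose Ag := [set x | A x /\ r g x].
  (* The part of [A] past [g] is uncountable and falls into countably many classes for [c]. *)
  have [n An] : exists n, infinite_set [set x | Ag x /\ c x = n].
    apply: contrapT => non; apply: Au.
    apply: (@sub_countable _ _ _
       ((\bigcup_n [set x | Ag x /\ c x = n]) `|` closed_seg r W g)).
      apply: subset_card_le => x Ax.
      have [rxg|xg|rgx] := tri x g; [right|right|left].
      + by split; [exact: AW|left].
      + by split; [exact: AW|right].
      + by exists (c x).
    rewrite /countable; apply: card_leU; [exact: infinite_nat|exact: countableP| |exact: clW].
    apply: bigcup_countable => // k _; apply: finite_set_countable.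
    by apply: contrapT => nk; apply: non; exists k.
  have [a [[Aa rga] ca]] := infinite_setN0 An.
  (* A term not killed by [f] comes from an index below [g], where [h s] and [h t] agree. So all
     members of a class yield the same scalar coefficients. *)
  have vloc s t k : Ag s -> Ag t -> c s = c t -> f (v s k) != 0 -> v t k = v s k.
    move=> [As rgs] [At rgt] cst fv; have [vs0|[z sz [hz vz]]] := vP s k.
      by rewrite vs0 linear0 eqxx in fv.
    have [Wz _] := sz.
    have zg : closed_seg r W g z.
      split=> //; left; apply: gP; split=> //.
      by apply: contraNneq fv => fz; rewrite vz linearZ/= fz scaler0.
    have tz : closed_seg r W t z.
      by split=> //; left; have [_ [rzg|->//]] := zg; exact: tr rzg rgt.
    rewrite vz -hz (cP s t _ _ rgs rgt cst z zg); [|exact: AW|exact: AW].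
    by apply: vE => //; exact: AW.
  have vf s t k : Ag s -> Ag t -> c s = c t -> f (v s k) = f (v t k).
    move=> As At cst; have [s0|sn0] := eqVneq (f (v s k)) 0; last by rewrite (vloc s t k).
    by have [t0|tn0] := eqVneq (f (v t k)) 0; [rewrite s0 t0|rewrite (vloc t s k)].
  have [M fM] := functional_bounded cf (v1 a).
  have fv := @power_series_eq0 R (fun n => f (v a n)) M
    (lam @` [set x | Ag x /\ c x = n]) _ _ fM.
  (* If [f (b x)] is nonzero, then [x] is below [g], so a multiple of [b x] occurs in [v a]; but the
     infinitely many zeros [lam k] kill every coefficient [f (v a n)]. *)
  apply: Dt => // _ /bS[x Wx <-]; apply/eqP; apply: contrapT => /negP fbx.
  have rxg : r x g by apply: gP.
  have sax : closed_seg r W a x by split=> //; left; exact: tr rxg rga.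
  move/negP: fbx; apply; apply/eqP; apply: linear_normalize_eq0.
  rewrite -(vE a x)//; last exact: AW.
  apply: fv.
    move=> lf; apply: An; apply: card_le_finite lf.
    apply: (@ex_card_le _ _ _ _ lam) => [k Ik|i j [[Ai _] _] [[Aj _] _] /lamI].
      by exists k.
    by rewrite !inE; apply; exact: AW.
  move=> _ [k [[Ak rgk] ck] <-]; have Wk := AW _ Ak.
  split; first exact: lamP.
  rewrite -(fA k Ak) (_ : series _ = series (fun n => lam k ^+ n * f (v k n))).
    by apply: power_sum_functional => //; exact: lamP.
  congr series; apply/funext => m; congr (_ * _); apply: vf => //.
  by rewrite ca ck.
pose Y := y @` W.
have Yt : total_set Y.
  by move=> f cf fY; apply: (key W) => // x Wx; apply: fY; exists x.
have Yd := total_linearly_dense Yt.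
have Yu : ~ countable Y by move=> /(card_is_dens_countable dK)/(_ Yd).
exists Y; split.
  apply: card_is_dens_eq dK _; apply/card_eqPle; split.
    by apply: card_le_trans (card_image_le _ _) _; exact: cseg_card_le rwo Wseg Ku.
  (* The lower bound on the cardinality of [Y] comes from its linear density, without injectivity of
     [y]. *)
  have Yi : infinite_set Y by move=> /finite_set_countable.
  have [E' E'd E'Y] := dense_card_le Yi (card_lexx Y) Yd.
  exact: card_le_trans (Kle _ E'd) E'Y.
move=> Z ZY ZeY; apply: total_linearly_dense => f cf fZ.
apply: (key [set x | W x /\ Z (y x)]) => //.
- by move=> x [].
- move=> Ac; apply: Yu; rewrite -(eq_countable ZeY).
  apply: sub_countable Ac; apply: (@surj_card_le _ _ _ _ y) => z Zz.
  by have [x Wx xz] := ZY _ Zz; exists x => //; split=> //; rewrite xz.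
- by move=> x [_ /fZ].
Qed.

Lemma overcomplete_le_omega1 Y : WLD X -> overcomplete Y -> Y #<= omega1.
Proof.
move=> [D Dd Dsupp] [[_ Yle] Yover]; apply: contrapT => Yw.
pose supp (g : X -> R) := [set d | D d /\ g d != 0].
pose B := [set g : X -> R | exists f, [/\ continuous f, g = f & exists x, f x != 0]].
have [F [FB Ftriv Fmax]] := ex_maximal_disjoint_subcollection supp B.
(* A nonzero functional vanishing on the union has support disjoint from all the others, so it could
   be added to [F]; if it is already in [F], it vanishes on its own support, hence on [D]. *)
have St : total_set (\bigcup_(g in F) supp g).
  move=> f cf fS; apply: contrapT => /existsNP[x /eqP fx].
  have Bf : B f by exists f; split=> //; exists x.
  have [Ff|nFf] := pselect (F f).
    suff : f x = 0 by apply/eqP.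
    apply: (linearly_dense_total Dd cf) => d Dd'.
    by apply/eqP; apply: contrapT => /negP fd; move: (fd); rewrite fS ?eqxx//; exists f.
  have fdisj g d : F g -> supp f d -> supp g d -> False.
    by move=> Fg [_ fd] gd; move: fd; rewrite fS ?eqxx//; exists g.
  apply: (Fmax (F `|` [set (f : X -> R)])).
  - split=> [g Fg|sub]; first by left.
    by apply: nFf; apply: sub; right.
  - by move=> g [/FB//|->].
  - move=> g g' [Fg|->] [Fg'|->] [d [gd g'd]] //.
    + by apply: Ftriv => //; exists d.
    + by case: (fdisj g d).
    + by case: (fdisj g' d).
have Fw : ~ (F #<= omega1).
  move=> Fw; apply: Yw.
  have [|E Ed Ew] := dense_card_le infinite_omega1 _ (total_linearly_dense St).
    apply: card_bigcup_le => //; first exact: infinite_omega1.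
    by move=> g /FB[f [cf -> _]]; exact: countable_le_omega1 (Dsupp f cf).
  exact: card_le_trans (Yle _ Ed) Ew.
have [r rwo] := ex_strict_wo (X -> R); have [tr tri mn] := rwo.
pose Z (g : X -> R) := [set y | Y y /\ g y = 0].
have [g Fg gu] : exists2 g, F g & ~ countable [set k : X -> R | F k /\ Z k #<= Z g].
  apply: contrapT => h; apply: Fw.
  have {}h g : F g -> countable [set k : X -> R | F k /\ Z k #<= Z g].
    by move=> Fg; apply: contrapT => ng; apply: h; exists g.
  (* [C] keeps the members of [F] whose zero set is larger than all earlier ones. If each member of
     [F] dominated only countably many others, [C] would have countable segments, and the sets
     dominated by its members would cover [F]. *)
  pose C := [set g | F g /\ forall k : X -> R, F k -> r k g -> ~ (Z g #<= Z k)].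
  have Cw : C #<= omega1.
    apply: (cseg_le_omega1 rwo) => g [Fg gC]; apply: sub_countable (h g Fg).
    apply: subset_card_le => f [[Ff _] rfg]; split=> //.
    by have [//|gf] := card_le_total (Z f) (Z g); case: (gC f Ff rfg).
  apply: (@card_le_trans _ _ _ (\bigcup_(g in C) [set k : X -> R | F k /\ Z k #<= Z g])).
    apply: subset_card_le => f Ff.
    have [|g [Fg fg] gmin] := mn [set g | F g /\ Z f #<= Z g].
      by exists f; split=> //; exact: card_lexx.
    exists g; split=> // k Fk rkg gk; apply: (gmin k) => //; split=> //.
    exact: card_le_trans fg gk.
  apply: card_bigcup_le => //; first exact: infinite_omega1.
  by move=> k [Fk _]; exact/countable_le_omega1/h.
have [W [WA Wu Wseg]] := ex_cseg rwo gu.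
have Ww := cseg_le_omega1 rwo Wseg.
(* The value at [y] is determined by countably many [d], and each [d] lies in at most one of the
   disjoint supports; so only countably many members of [W] are nonzero at [y]. *)
have YZ : Y `<=` \bigcup_(k in W) Z k.
  move=> y Yy; apply: contrapT => ny; apply: Wu.
  have [C [CD Cc Cy]] := countable_support y Dd.
  apply: (@sub_countable _ _ _ (\bigcup_(d in C) [set k : X -> R | W k /\ k d != 0])).
    apply: subset_card_le => k Wk; have [Fk _] := WA _ Wk.
    apply: contrapT => nk; apply: ny; exists k => //; split=> //.
    have [f [cf kf _]] := FB _ Fk; rewrite kf; apply: Cy => // d Cd.
    apply/eqP; apply: contrapT => /negP fd; apply: nk; exists d => //.
    by split=> //; rewrite kf.
  apply: bigcup_countable => // d Cd; have Dd' := CD _ Cd.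
  have [->|/set0P[k [Wk kd]]] := eqVneq [set k : X -> R | W k /\ k d != 0] set0.
    exact: countable0.
  apply: sub_countable (countable1 k); apply: subset_card_le => k' [Wk' k'd].
  have [Fk _] := WA _ Wk; have [Fk' _] := WA _ Wk'.
  by apply: Ftriv => //; exists d.
have YT (T : Type) (S : set T) : infinite_set S -> omega1 #<= S -> Z g #<= S -> Y #<= S.
  move=> Si wS ZS; apply: card_le_trans (subset_card_le YZ) _.
  apply: card_bigcup_le => //; first exact: card_le_trans Ww wS.
  by move=> f /WA[_ fg]; exact: card_le_trans fg ZS.
have [Zw|wZ] := card_le_total (Z g) omega1.
  by apply: Yw; apply: YT => //; exact: infinite_omega1.
have YZg : Y #<= Z g.
  by apply: YT => //; exact: infinite_card_le infinite_omega1 wZ.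
have ZY : Z g `<=` Y by move=> y [].
(* [Z g] now has the cardinality of [Y], so it is linearly dense, although the nonzero [g] vanishes
   on it. *)
have [f [cf gf [x]]] := FB g Fg.
have Zd : linearly_dense (Z g).
  by apply: Yover => //; apply/card_eqPle; split=> //; exact: subset_card_le.
rewrite (linearly_dense_total Zd cf) ?eqxx// => y [_].
by rewrite gf.
Qed.

End Overcomplete.

Theorem corollary12 (R : realType) (X : completeNormedModType R)
  (dimX : infinite_dimensional X) (wldX : WLD X) :
  (exists Y : set X, overcomplete Y) <->
  (exists2 K : set X, card_is_dens K & K #<= omega1).
Proof.
split=> [[Y Yover]|[K dK Kw]].
  by exists Y; [case: Yover|exact: overcomplete_le_omega1].
have [Kc|Ku] := pselect (countable K); first exact: separable_overcomplete dK Kc.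
exact: nonseparable_overcomplete dK Kw Ku.
Qed.
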